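(* Let $\alpha\in(0,1)$, let $f$ and $g$ be Laplace-transformable functions, let $A$ be a constant, and put $k=\frac{1-\alpha}{B(\alpha)}A$. The unique Laplace-transformable solution $f$ to the equation $$ {}^{ABC}D^{\alpha}_{0+}f(t)-Af(t)=g(t) $$ is given by $$ f(t)=-\frac{1}{A}g(t)+\frac{1}{A(1-k)}\frac{\mathrm{d}}{\mathrm{d}t}\int_0^tE_{\alpha}\Big(\frac{k\alpha}{(1-k)(1-\alpha)}(t-x)^{\alpha}\Big)g(x)\,\mathrm{d}x+\frac{1}{1-k}E_{\alpha}\Big(\frac{k\alpha}{(1-k)(1-\alpha)}t^{\alpha}\Big)f(0) $$ $$ =\frac{k}{A(1-k)}g(t)+\frac{1}{A(1-k)}\int_0^t\frac{\mathrm{d}}{\mathrm{d}t}E_{\alpha}\Big(\frac{k\alpha}{(1-k)(1-\alpha)}(t-x)^{\alpha}\Big)g(x)\,\mathrm{d}x+\frac{1}{1-k}E_{\alpha}\Big(\frac{k\alpha}{(1-k)(1-\alpha)}t^{\alpha}\Big)f(0). $$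
   Context: The Mittag-Leffler function is $E_\alpha(x)=\sum_{n=0}^\infty \frac{x^n}{\Gamma(\alpha n+1)}$. $B$ is a fixed normalisation function with real, strictly positive values and $B(0)=B(1)=1$. The ABC fractional derivative is $$ {}^{ABC}D^{\alpha}_{0+}f(t)=\frac{B(\alpha)}{1-\alpha}\int_0^t f'(x)E_\alpha\Big(\frac{-\alpha}{1-\alpha}(t-x)^{\alpha}\Big)\,\mathrm{d}x. $$ A function is Laplace-transformable if it has a well-defined Laplace transform.
   Formalization: Solutions f are taken locally absolutely continuous, and existence is claimed only for locally absolutely continuous g (a step function g has no solution; a Cantor function f breaks the formula). Also A≠0, k≠1, all values are real, and the equation is imposed for t>0. *)

(* Defs.v *)
From HB Require Import structures.
From mathcomp Require Import all_boot all_order all_algebra.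
From mathcomp Require Import all_classical all_reals all_analysis.

Set Implicit Arguments.
Unset Strict Implicit.
Unset Printing Implicit Defensive.

Import Order.TTheory GRing.Theory Num.Theory.
Import numFieldNormedType.Exports.

Local Open Scope classical_set_scope.
Local Open Scope ring_scope.

(* Euler's integral; meaningful for 0 < z. *)
Definition Gamma_fun (R : realType) (z : R) : R :=
  \int[@lebesgue_measure R]_(x in `]0, +oo[) (x `^ (z - 1) * expR (- x)).

Definition mittag_leffler (R : realType) (alpha x : R) : R :=
  limn (series (fun n : nat => x ^+ n / Gamma_fun (alpha * n%:R + 1))).

(* Functions on [0, +oo[ are represented by total functions R -> R whose values
   on negative arguments are never used. The Laplace integral is a Lebesgue
   integral: its convergence at one real s gives its convergence on the whole
   half-plane Re >= s. *)
Definition laplace_transformable (R : realType) (f : R -> R) : Prop :=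
  exists s : R, (@lebesgue_measure R).-integrable `[0, +oo[
    (fun t => (expR (- (s * t)) * f t)%:E).

(* Local absolute continuity on [0, +oo[, as being a primitive of a locally
   integrable function. Such an f is differentiable almost everywhere and is the
   integral of its derivative; this is what makes ABC_derivative below
   well defined. *)
Definition locally_AC (R : realType) (f : R -> R) : Prop :=
  exists h : R -> R,
    (forall T : R, 0 <= T ->
      (@lebesgue_measure R).-integrable `[0, T] (fun x => (h x)%:E)) /\
    (forall t : R, 0 <= t ->
      f t = f 0 + \int[@lebesgue_measure R]_(x in `[0, t]) h x).

(* derive1 f takes a junk value at points where f is not derivable; for a locally
   absolutely continuous f these form a null set. *)
Definition ABC_derivative (R : realType) (B : R -> R) (alpha : R) (f : R -> R)
    (t : R) : R :=
  B alpha / (1 - alpha) *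
  \int[@lebesgue_measure R]_(x in `[0, t])
    (derive1 f x *
     mittag_leffler alpha (- alpha / (1 - alpha) * (t - x) `^ alpha)).

(* Laplace-transformable solutions of  ABC_derivative f - A f = g  on ]0, +oo[. *)
Definition ABC_solution (R : realType) (B : R -> R) (alpha A : R)
    (g f : R -> R) : Prop :=
  [/\ laplace_transformable f, locally_AC f &
      forall t : R, 0 < t -> ABC_derivative B alpha f t - A * f t = g t].

(* Main.v *)
Require Import Defs.
From HB Require Import structures.
From mathcomp Require Import all_boot all_order all_algebra.
From mathcomp Require Import all_classical all_reals all_analysis.
From mathcomp Require Import measurable_realfun ring lra.

Set Implicit Arguments.
Unset Strict Implicit.
Unset Printing Implicit Defensive.

Import Order.TTheory GRing.Theory Num.Theory.
Import numFieldNormedType.Exports.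

Local Open Scope classical_set_scope.
Local Open Scope ring_scope.

(** Let a * c be the convolution of functions on the half-line, P the kernel
t^(alpha-1) / Gamma(alpha) and K_m the kernel t^(alpha-1) E_{alpha,alpha}(m
t^alpha). Termwise, p_a * p_b = p_{a+b} for p_b(t) = t^(b-1) / Gamma(b), which
is the beta integral [integral_beta], gives E_alpha(m t^alpha) = 1 + m (1 * K_m)
and K_m = P + m (P * K_m) [conv_power_ml_kernel, mittag_leffler_relaxation].
Hence the K_m form a resolvent family: K_m - K_n = (m - n) K_m * K_n
[ml_kernel_resolvent].

Put b = B(alpha) / (1 - alpha), so that A = b k, and let e(t) = E_alpha(n
t^alpha) with n = - alpha / (1 - alpha), so that e = 1 + 1 * q for q = n K_n. If
f has the density h, the ABC derivative of f is b (e * h), and e * h =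
(f - f(0)) + q * (f - f(0)) no longer contains a derivative. The equation
becomes a Volterra equation of the second kind [relaxation_operatorE],
  L f - b f(0) e = g,   where L u = b (1 - k) u + b (q * u).
With m = k alpha / ((1 - k) (1 - alpha)) and r = m K_m, the resolvent identity
reads (1 - k) r + k q + r * q = 0. It says that L has the inverse
  u |-> u / (b (1 - k)) + (r * u) / (b k (1 - k))
[volterra_opK, volterra_invK], and that L maps E / (1 - k) to b e, where E =
1 + 1 * r is the function E_alpha(m t^alpha) of the theorem. So the equation is
L (f - f(0) E / (1 - k)) = g, and applying the inverse gives the second formula,
as r = E'. The first one is the same since E * g is a primitive of g + r * g.

The function g is only locally integrable, so the formulas determine it a priori
only almost everywhere. Integrating the formula once makes every function
locally bounded, where convolution is associative at each point [convA], and one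
obtains g = L u almost everywhere, u = f - f(0) E / (1 - k)
[volterra_inv_ae]. But u, hence L u, is absolutely continuous, and convolutions
do not see null sets; putting L u for g in the convolutions turns the
almost everywhere identity into an identity at every t > 0
[derivative_formula, kernel_formula].

Two solutions have the same value at 0 because L u is continuous at 0, equal to
g on the open half-line, and takes the value - A f(0) at 0. For an absolutely
continuous g, taking f(0) = - g(0) / A in the second formula gives a solution.
Its Laplace transformability rests on the exponential bound for K_m
[laplace_ml_kernel], which like the convergence of the Mittag-Leffler series
comes from a lower bound for Gamma with a free parameter [Gamma_fun_ge]. *)

(** * Affine changes of variable *)

Section affine.
Context {R : realType}.
Notation mu := (@lebesgue_measure R).

Let affine (c d x : R) := c * x + d.

Let measurable_affine c d : measurable_fun [set: R] (affine c d).
Proof.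
by apply: measurable_funD => //; exact: measurable_funM.
Qed.

(** Up to the factor |c| both sides are measures in A, and they agree on
half-open intervals. *)
Lemma lebesgue_measure_affine (c d : R) (A : set R) : c != 0 -> measurable A ->
  mu (affine c d @^-1` A) = (`|c|^-1%:E * mu A)%E.
Proof.
move=> c0 mA.
have -> : mu A = mscale (`|c|%:nng) (pushforward mu
    (affine c d : measurableTypeR R -> measurableTypeR R)) A.
- move=> mphi; apply: lebesgue_measure_unique => // _ [[a b] _ <-].
  change (mu `]a, b] = `|c|%:E * mu (affine c d @^-1` `]a, b]))%E.
  have [c_gt0|c_lt0|c_eq0] := ltgtP 0 c; last by rewrite -c_eq0 eqxx in c0.
  - rewrite [X in (_ * mu X)%E](_ : _ = `](a - d) / c, (b - d) / c]%classic); last first.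
      apply/seteqP; split => x /=; rewrite !in_itv/= /affine
        ltr_pdivrMr// ler_pdivlMr// ltrBlDr lerBrDr [x * c]mulrC //.
    rewrite !lebesgue_measure_itv/= !lte_fin ltr_pM2r ?invr_gt0// ltrD2r.
    case: ifPn => _; last by rewrite mule0.
    rewrite gtr0_norm// -!EFinB -EFinM; congr EFin; field.
    by rewrite c0.
  - rewrite [X in (_ * mu X)%E](_ : _ = `[(b - d) / c, (a - d) / c[%classic); last first.
      apply/seteqP; split => x /=; rewrite !in_itv/= /affine
        ltr_ndivlMr// ler_ndivrMr// ltrBlDr lerBrDr [x * c]mulrC andbC //.
    rewrite !lebesgue_measure_itv/= !lte_fin ltr_nM2r ?invr_lt0// ltrD2r.
    case: ifPn => _; last by rewrite mule0.
    rewrite ltr0_norm// -!EFinB -EFinM; congr EFin; field.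
    by rewrite c0.
- exact: measurable_affine.
move=> mphi; rewrite /mscale /= /pushforward muleA -EFinM mulVf ?normr_eq0//.
by rewrite mul1e.
Qed.

Lemma ge0_integral_affine (c d : R) (f : R -> \bar R) : c != 0 ->
  measurable_fun setT f -> (forall x, 0 <= f x)%E ->
  (\int[mu]_x f (affine c d x) = `|c|^-1%:E * \int[mu]_x f x)%E.
Proof.
move=> c0 mf f0.
have cn0 : 0 <= `|c|^-1 by rewrite invr_ge0.
transitivity (\int[mscale (NngNum cn0) mu]_x f x)%E; last first.
  exact: ge0_integral_mscale.
transitivity (\int[pushforward mu
    (affine c d : measurableTypeR R -> measurableTypeR R)]_x f x)%E.
- by rewrite ge0_integral_pushforward//; exact: measurable_affine.
apply: eq_measure_integral => [|mphi A mA _]; first exact: measurable_affine.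
transitivity (mu (affine c d @^-1` A)); first by [].
by rewrite lebesgue_measure_affine.
Qed.

End affine.

Section L1_line.
Context {R : realType}.
Notation mu := (@lebesgue_measure R).

Notation L1 F := (mu.-integrable [set: R] (EFin \o F)).

(** The substitution is made separately in the positive and the negative part
of f, so that the two sides agree also when the integral is infinite or
undefined. *)
Lemma integral_isometry (c d : R) (f : R -> \bar R) : `|c| = 1 ->
  measurable_fun setT f -> (\int[mu]_x f (c * x + d)%R = \int[mu]_x f x)%E.
Proof.
move=> c1 mf.
have c0 : c != 0 by rewrite -normr_eq0 c1 oner_eq0.
have mfp := measurable_funepos mf; have mfn := measurable_funeneg mf.
rewrite integralE [RHS]integralE.
rewrite (funepos_comp f (fun x => (c * x + d)%R)).
rewrite (funeneg_comp f (fun x => (c * x + d)%R)) /=.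
by rewrite !ge0_integral_affine// c1 invr1 !mul1e.
Qed.

Let measurable_aff (c d : R) : measurable_fun [set: R] (fun x => c * x + d).
Proof. by apply: measurable_funD => //; exact: measurable_funM. Qed.

Lemma measurable_L1 (F : R -> R) : L1 F -> measurable_fun setT F.
Proof. by move=> /measurable_int/measurable_EFinP. Qed.

Lemma L1_affine (F : R -> R) (c d : R) : c != 0 ->
  L1 F -> L1 (fun x => F (c * x + d)).
Proof.
move=> c0 iF; have mF := measurable_L1 iF.
apply/integrableP; split.
  by apply/measurable_EFinP; exact: (measurableT_comp mF (measurable_aff _ _)).
rewrite (@ge0_integral_affine _ _ _ (abse \o (EFin \o F)))//; last first.
- by move=> x; exact: abse_ge0.
- by apply: measurableT_comp => //; exact/measurable_EFinP.
by rewrite lte_mul_pinfty//; case/integrableP : iF.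
Qed.

(** Tonelli with the integral in the first variable inside: for fixed second
variable, an isometry turns it into the norm of F. *)
Lemma integrable_kernel21 (F G : R -> R) (a b : R) : `|a| = 1 ->
  L1 F -> L1 G ->
  (mu \x mu)%E.-integrable setT (fun z => (G z.2 * F (a * z.1 + b * z.2))%:E).
Proof.
move=> a1 iF iG.
have mF := measurable_L1 iF; have mG := measurable_L1 iG.
have mK : measurable_fun [set: R * R]
    (fun z => (G z.2 * F (a * z.1 + b * z.2))%:E).
  apply/measurable_EFinP; apply: measurable_funM; first exact: measurableT_comp.
  apply: measurableT_comp => //.
  by apply: measurable_funD; exact: measurable_funM.
apply/(@integrable21ltyP _ _ _ _ R mu mu _ mK) => /=.
under eq_integral => y _.
  under eq_integral => x _ do rewrite normrM EFinM.
  rewrite ge0_integralZl//; last first.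
    apply/measurable_EFinP; apply: measurableT_comp => //.
    exact: (measurableT_comp mF (measurable_aff _ _)).
  rewrite (@integral_isometry a (b * y) (fun x => `|F x|%:E))//; last first.
    by apply/measurable_EFinP; exact: measurableT_comp.
  over.
have [_ oF] := integrableP _ _ _ iF; have [_ oG] := integrableP _ _ _ iG.
rewrite /= ge0_integralZr//.
- by rewrite lte_mul_pinfty// ?integral_ge0// ge0_fin_numE// integral_ge0.
- by apply/measurable_EFinP; exact: measurableT_comp.
- by rewrite integral_ge0.
Qed.

(** The other order of integration; here the factor G depends on the outer
variable. *)
Lemma integrable_kernel12 (F G : R -> R) (a b : R) : `|b| = 1 ->
  L1 F -> L1 G ->
  (mu \x mu)%E.-integrable setT (fun z => (G z.1 * F (a * z.1 + b * z.2))%:E).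
Proof.
move=> b1 iF iG.
have mF := measurable_L1 iF; have mG := measurable_L1 iG.
have mK : measurable_fun [set: R * R]
    (fun z => (G z.1 * F (a * z.1 + b * z.2))%:E).
  apply/measurable_EFinP; apply: measurable_funM; first exact: measurableT_comp.
  apply: measurableT_comp => //.
  by apply: measurable_funD; exact: measurable_funM.
apply/(@integrable12ltyP _ _ _ _ R mu mu _ mK) => /=.
under eq_integral => y _.
  under eq_integral => x _ do rewrite normrM EFinM.
  rewrite ge0_integralZl//; last first.
    apply/measurable_EFinP; apply: measurableT_comp => //.
    under eq_fun do rewrite addrC.
    exact: (measurableT_comp mF (measurable_aff _ _)).
  under eq_integral => x _ do rewrite (addrC (a * y)).
  rewrite (@integral_isometry b (a * y) (fun x => `|F x|%:E))//; last first.
    by apply/measurable_EFinP; exact: measurableT_comp.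
  over.
have [_ oF] := integrableP _ _ _ iF; have [_ oG] := integrableP _ _ _ iG.
rewrite /= ge0_integralZr//.
- by rewrite lte_mul_pinfty// ?integral_ge0// ge0_fin_numE// integral_ge0.
- by apply/measurable_EFinP; exact: measurableT_comp.
- by rewrite integral_ge0.
Qed.

End L1_line.

(** * Convolution on the half-line *)

Section convolution.
Context {R : realType}.
Notation mu := (@lebesgue_measure R).
Notation L1 F := (mu.-integrable [set: R] (EFin \o F)).

Definition loc_integrable (f : R -> R) : Prop := forall T : R, 0 <= T ->
  mu.-integrable `[0, T] (fun x => (f x)%:E).

Definition conv (a b : R -> R) (t : R) : R :=
  \int[mu]_(x in `[0, t]) (a (t - x) * b x).

Lemma convE a b t :
  conv a b t = \int[mu]_(x in `[0, t]) (a (t - x) * b x).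
Proof. by []. Qed.

Definition loc_bounded (f : R -> R) : Prop := forall T : R, 0 <= T ->
  measurable_fun `[0, T] f /\
  exists M : R, forall x, 0 <= x <= T -> `|f x| <= M.

(** Cutting to [0, T] and extending by 0 makes a convolution at t <= T a
convolution on the whole line, where Fubini needs no bookkeeping of domains. *)
Let cut (T : R) (f : R -> R) : R -> R := f \_ `[0, T].

Let cutE T f x : cut T f x = if 0 <= x <= T then f x else 0.
Proof.
rewrite /cut patchE; have [|] := boolP (0 <= x <= T) => h.
  by rewrite mem_set//= in_itv.
by rewrite memNset//= in_itv/=; exact/negP.
Qed.

Let L1_cut T f : loc_integrable f -> L1 (cut T f).
Proof.
move=> lf; have [T0|T0] := leP 0 T.
  by have /integrable_mkcond := lf T T0; rewrite -restrict_EFin; exact.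
have -> : cut T f = cst 0; last exact: integrable0.
apply/funext => x; rewrite cutE; case: ifPn => // /andP[x0 xT].
by move: (le_trans x0 xT); rewrite leNgt T0.
Qed.

Let conv_cut T a b t : t <= T ->
  conv a b t = \int[mu]_x (cut T a (t - x) * cut T b x).
Proof.
move=> tT; rewrite /conv Rintegral_mkcond; apply: eq_Rintegral => x _.
rewrite patchE !cutE; have [xt|xt] := boolP (x \in `[0, t]%classic).
  move: xt; rewrite inE/= in_itv/= => /andP[x0 xt].
  by rewrite x0 (le_trans xt tT) subr_ge0 xt/= ifT// lerBlDr (le_trans tT)// lerDl.
case: ifPn => [/andP[tx _]|]; last by rewrite mul0r.
case: ifPn => [/andP[x0 _]|]; last by rewrite mulr0.
by move: xt; rewrite mem_set//= in_itv/= x0 -subr_ge0.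
Qed.

Lemma convC a b : loc_integrable a -> loc_integrable b -> conv a b = conv b a.
Proof.
move=> la lb; apply/funext => t.
rewrite !(@conv_cut t)// /Rintegral; congr fine.
have mA := measurable_L1 (L1_cut t la); have mB := measurable_L1 (L1_cut t lb).
have maff : measurable_fun [set: R] (fun x => t - x).
  by apply: measurable_funB.
rewrite -(@integral_isometry _ (-1) t (fun x => (cut t a (t - x) * cut t b x)%:E)).
- apply: eq_integral => x _; congr EFin.
  by rewrite mulN1r (addrC (- x)) subKr mulrC.
- by rewrite normrN1.
- apply/measurable_EFinP; apply: measurable_funM => //.
  exact: (measurableT_comp mA maff).
Qed.

Let norm_fine_le (y : \bar R) : (`|fine y|%:E <= `|y|)%E.
Proof. by case: y => [r| |] /=; rewrite ?normr0 ?lexx ?leey. Qed.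

(** Fubini for the kernel b(y) a(x - y). Where the inner integral diverges, conv
takes the default value 0, which keeps the bound. *)
Lemma loc_integrable_conv a b : loc_integrable a -> loc_integrable b ->
  loc_integrable (conv a b).
Proof.
move=> la lb T T0.
pose K := fun z : R * R => (cut T b z.2 * cut T a (1 * z.1 + -1 * z.2))%:E.
have ik : (mu \x mu)%E.-integrable setT K.
  by apply: integrable_kernel21; rewrite ?normr1//; exact: L1_cut.
have := @integrable_fubini_F _ _ _ _ R mu mu _ ik.
move=> /(@integrableS _ _ _ mu _ `[0, T]) => /(_ measurableT) iF.
have {}iF : mu.-integrable `[0, T] _ := iF (measurable_itv _) (@subsetT _ _).
have [mF _] := integrableP _ _ _ iF.
have convE x : 0 <= x <= T -> conv a b x = fine (fubini_F mu K x).
  move=> /andP[x0 xT]; rewrite (conv_cut _ _ xT) /Rintegral /fubini_F.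
  congr fine; apply: eq_integral => y _ /=.
  by rewrite /K/= mul1r mulN1r mulrC.
apply: le_integrable iF => //.
- apply: (eq_measurable_fun (fun x => (fine (fubini_F mu K x))%:E)).
    by move=> x; rewrite inE/= in_itv/= => /convE ->.
  by apply/measurable_EFinP; exact: measurableT_comp.
- move=> x; rewrite /= in_itv/= => /convE ->.
  exact: norm_fine_le.
Qed.

Lemma integrableM_bounded (D : set R) (f g : R -> R) (M : R) : measurable D ->
  mu.-integrable D (EFin \o f) -> measurable_fun D g ->
  (forall x, D x -> `|g x| <= M) ->
  mu.-integrable D (fun x => (f x * g x)%:E).
Proof.
move=> mD /[dup] iF /integrableP[/measurable_EFinP mf _] mg gM.
have iMf : mu.-integrable D (fun x => M%:E * (f x)%:E)%E.
  by apply: integrableZl.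
apply: le_integrable iMf => //.
- by apply/measurable_EFinP; exact: measurable_funM.
- move=> x Dx; rewrite /= lee_fin !normrM mulrC ler_wpM2r//.
  by rewrite (le_trans (gM x Dx))// ler_norm.
Qed.

Lemma loc_integrable_bounded f : loc_bounded f -> loc_integrable f.
Proof.
move=> bf T T0; have [mf [M fM]] := bf T T0.
have -> : (fun x => (f x)%:E) = (fun x => (cst 1 x * f x)%:E).
  by apply/funext => x; rewrite /= mul1r.
apply: (@integrableM_bounded _ (cst 1) f M) => //.
  apply: continuous_compact_integrable; first exact: segment_compact.
  by apply: continuous_subspaceT => x; exact: cst_continuous.

Qed.

(** Fubini for a(t - x) b(x - y) c(y). As c is bounded, this is dominated for the
given t by the integrable kernel a(t - x) b(x - y), so that the identity holds
at every t and not only almost everywhere. *)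
Lemma convA a b c : loc_integrable a -> loc_integrable b -> loc_bounded c ->
  conv a (conv b c) = conv (conv a b) c.
Proof.
move=> la lb bc; have lc := loc_integrable_bounded bc; apply/funext => t.
have [t0|t0] := leP 0 t; last first.
  by rewrite /conv !set_itv_ge ?bnd_simp -?ltNge// !Rintegral_set0.
have iA := L1_cut t la; have iB := L1_cut t lb; have iC := L1_cut t lc.
have mA := measurable_L1 iA; have mB := measurable_L1 iB.
have mC := measurable_L1 iC.
have [_ [M cM]] := bc t t0.
have M0 : 0 <= M.
  by rewrite (le_trans (normr_ge0 _) (cM 0 _))// lexx.
have CM x : `|cut t c x| <= M.
  by rewrite cutE; case: ifPn => [/cM//|]; rewrite normr0.
have mt : measurable_fun [set: R] (fun x => t - x).
  by apply: measurable_funB.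
have iAt : L1 (fun x => cut t a (t - x)).
  have := @L1_affine _ _ (-1) t _ iA; rewrite oppr_eq0 oner_eq0 => /(_ isT).
  by under eq_fun do rewrite mulN1r (addrC (- _)).
pose K0 := fun z : R * R => (cut t a (t - z.1) * cut t b (1 * z.1 + -1 * z.2))%:E.
have iK0 : (mu \x mu)%E.-integrable setT K0.
  by apply: (@integrable_kernel12 _ (cut t b) (fun x => cut t a (t - x)));
    rewrite ?normrN1.
have [mK0 _] := integrableP _ _ _ iK0.
pose K z := (K0 z * (cut t c z.2)%:E)%E.
have iK : (mu \x mu)%E.-integrable setT K.
  have iMK : (mu \x mu)%E.-integrable setT (fun z => M%:E * K0 z)%E.
    by apply: integrableZl.
  apply: le_integrable iMK => //.
  - apply: emeasurable_funM => //.
    by apply/measurable_EFinP; exact: measurableT_comp.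
  - move=> z _; rewrite /K !abseM muleC lee_wpmul2r// ?abse_ge0//=.
    by rewrite lee_fin (ger0_norm M0).
have := @Fubini _ _ _ _ R mu mu K iK.
have -> : (\int[mu]_x \int[mu]_y K (x, y) =
    \int[mu]_x (cut t a (t - x) * cut t (conv b c) x)%:E)%E.
  apply: eq_integral => x _.
  under eq_integral => y _ do
    rewrite /K /K0/= mul1r mulN1r -EFinM -mulrA EFinM.
  rewrite integralZl//; last first.
    apply: integrableM_bounded => //.
    have := @L1_affine _ _ (-1) x _ iB; rewrite oppr_eq0 oner_eq0 => /(_ isT).
    by under eq_fun do rewrite mulN1r (addrC (- _)).
  rewrite EFinM [cut t (conv b c) x]cutE.
  case: ifPn => [/andP[x0 xt]|xt].
    rewrite (conv_cut _ _ xt) /Rintegral fineK//.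
    apply: integrable_fin_num => //; apply: integrableM_bounded => //.
    have := @L1_affine _ _ (-1) x _ iB; rewrite oppr_eq0 oner_eq0 => /(_ isT).
    by under eq_fun do rewrite mulN1r (addrC (- _)).
  rewrite cutE; case: ifPn => [/andP[h1 h2]|]; last by rewrite !mul0e.
  by move: xt => /negP[]; apply/andP; split; lra.
have -> : (\int[mu]_y \int[mu]_x K (x, y) =
    \int[mu]_y (cut t (conv a b) (t - y) * cut t c y)%:E)%E.
  apply: ae_eq_integral => //.
  - exact: (@measurable_fubini_G _ _ _ _ R mu mu K iK).
  - apply/measurable_EFinP; apply: measurable_funM => //.
    apply: (measurableT_comp _ mt); apply: measurable_L1; apply: L1_cut.
    exact: loc_integrable_conv.
  have := @ae_integrable2 _ _ _ _ R mu mu K0 iK0.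
  apply: filterS => y iy _; rewrite /K /= integralZr// [cut t c y]cutE.
  case: ifPn => [/andP[y0 yt]|]; last by rewrite mulr0 mule0.
  rewrite EFinM cutE subr_ge0 yt lerBlDr lerDl y0/=; congr (_ * _)%E.
  rewrite (@conv_cut t); last by rewrite lerBlDr lerDl.
  rewrite /Rintegral.
  rewrite -(@integral_isometry _ 1 (- y) (fun x => (cut t a (t - y - x) * cut t b x)%:E)).
  - under [in RHS]eq_integral => x _ do
      rewrite mul1r opprD opprK addrACA addNr addr0.
    rewrite fineK; last first.
      have := integrable_fin_num measurableT iy.
      by rewrite /K0/=; under eq_integral => x _ do rewrite mul1r mulN1r.
    by apply: eq_integral => x _; rewrite /K0/= mul1r mulN1r.
  - by rewrite normr1.
  - apply/measurable_EFinP; apply: measurable_funM => //.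
    by apply: (measurableT_comp mA); exact: measurable_funB.
move=> E; rewrite (@conv_cut t _ _ t)// [RHS](@conv_cut t _ _ t)//.
by rewrite /Rintegral E.
Qed.

Lemma integrable_reflect a t : loc_integrable a ->
  mu.-integrable `[0, t] (fun x => (a (t - x))%:E).
Proof.
move=> la; have iA := L1_cut t la.
have iAt : L1 (fun x => cut t a (t - x)).
  have := @L1_affine _ _ (-1) t _ iA; rewrite oppr_eq0 oner_eq0 => /(_ isT).
  by under eq_fun do rewrite mulN1r (addrC (- _)).
apply: (@eq_integrable _ _ _ mu _ _ (fun x => (cut t a (t - x))%:E)) => //.
  move=> x; rewrite inE/= in_itv/= cutE => /andP[x0 xt].
  by rewrite subr_ge0 xt lerBlDr lerDl x0.
by apply: integrableS iAt.
Qed.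

End convolution.

Section convolution_algebra.
Context {R : realType}.
Notation mu := (@lebesgue_measure R).
Implicit Types a b c f g h : R -> R.

Lemma loc_integrableP f : loc_integrable f <->
  forall T, mu.-integrable `[0, T] (fun x => (f x)%:E).
Proof.
split=> [lf T|lf T _]; last exact: lf.
have [/lf//|T0] := leP 0 T.
by rewrite set_itv_ge ?bnd_simp -?ltNge//; exact: integrable_set0.
Qed.

Lemma conv_integrable a c t : loc_integrable a -> loc_bounded c ->
  mu.-integrable `[0, t] (fun x => (a (t - x) * c x)%:E).
Proof.
move=> la bc; have [t0|t0] := leP 0 t; last first.
  by rewrite set_itv_ge ?bnd_simp -?ltNge//; exact: integrable_set0.
have [mc [M cM]] := bc t t0.
apply: integrableM_bounded mc _ => //; first exact: integrable_reflect.
by move=> x; rewrite /= in_itv; exact: cM.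
Qed.

Lemma loc_integrableD a b : loc_integrable a -> loc_integrable b ->
  loc_integrable (a + b).
Proof.
by move=> la lb T T0; have := integrableD _ (la T T0) (lb T T0); exact.
Qed.

Lemma loc_integrableZ k a : loc_integrable a -> loc_integrable (k *: a).
Proof.
by move=> la T T0; have := integrableZl _ k (la T T0); exact.
Qed.

Lemma loc_boundedD a b : loc_bounded a -> loc_bounded b -> loc_bounded (a + b).
Proof.
move=> ba bb T T0; have [ma [M aM]] := ba T T0; have [mb [N bN]] := bb T T0.
split; first exact: measurable_funD.
by exists (M + N) => x x0T; rewrite (le_trans (ler_normD _ _))// lerD ?aM ?bN.
Qed.

Lemma loc_boundedZ k a : loc_bounded a -> loc_bounded (k *: a).
Proof.
move=> ba T T0; have [ma [M aM]] := ba T T0.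
split; first by apply: measurable_funM.
by exists (`|k| * M) => x x0T; rewrite normrM ler_wpM2l// aM.
Qed.

Lemma loc_bounded_cst (k : R) : loc_bounded (cst k : R -> R).
Proof. by move=> T T0; split => //; exists `|k|. Qed.

Lemma convDl a a' c : loc_integrable a -> loc_integrable a' -> loc_bounded c ->
  conv (a + a') c = conv a c + conv a' c.
Proof.
move=> la la' bc; apply/funext => t.
rewrite -[RHS]/(conv a c t + conv a' c t) /conv -RintegralD//.
- by apply: eq_Rintegral => x _; rewrite -mulrDl.
- exact: conv_integrable.
- exact: conv_integrable.
Qed.

Lemma convZl k a c : loc_integrable a -> loc_bounded c ->
  conv (k *: a) c = k *: conv a c.
Proof.
move=> la bc; apply/funext => t.
rewrite -[RHS]/(k * conv a c t) /conv -RintegralZl//.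
- by apply: eq_Rintegral => x _; rewrite mulrA.
- exact: conv_integrable.
Qed.

Lemma convDr a c c' : loc_integrable a -> loc_bounded c -> loc_bounded c' ->
  conv a (c + c') = conv a c + conv a c'.
Proof.
move=> la bc bc'; apply/funext => t.
rewrite -[RHS]/(conv a c t + conv a c' t) /conv -RintegralD//.
- by apply: eq_Rintegral => x _; rewrite -mulrDr.
- exact: conv_integrable.
- exact: conv_integrable.
Qed.

Lemma convZr k a c : loc_integrable a -> loc_bounded c ->
  conv a (k *: c) = k *: conv a c.
Proof.
move=> la bc; apply/funext => t.
rewrite -[RHS]/(k * conv a c t) /conv -RintegralZl//.
- by apply: eq_Rintegral => x _; rewrite mulrCA.
- exact: conv_integrable.
Qed.

Lemma conv1E a t : loc_integrable a -> conv (cst 1) a t = \int[mu]_(x in `[0, t]) a x.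
Proof. by move=> la; apply: eq_Rintegral => x _; rewrite /= mul1r. Qed.

(** The bound on [0, T] is sup |c| times the integral of |a|. *)
Lemma loc_bounded_conv a c : loc_integrable a -> loc_bounded c -> loc_bounded (conv a c).
Proof.
move=> la bc T T0; have [_ [M cM]] := bc T T0.
have lac := loc_integrable_conv la (loc_integrable_bounded bc).
have la1 : loc_integrable (fun x => `|a x|).
  by move=> S S0; have := integrable_abse (la S S0); exact.
have M0 : 0 <= M by rewrite (le_trans (normr_ge0 _) (cM 0 _))// lexx.
split.
  by apply/measurable_EFinP; exact: measurable_int (lac T T0).
exists (M * \int[mu]_(x in `[0, T]) `|a x|) => t /andP[t0 tT].
rewrite (le_trans (le_normr_Rintegral _ _))//; first exact: conv_integrable.
apply: (@le_trans _ _ (\int[mu]_(x in `[0, t]) (`|a (t - x)| * M))).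
  apply: le_Rintegral => //.
  - by have := integrable_abse (conv_integrable t la bc); exact.
  - exact: (conv_integrable t la1 (loc_bounded_cst M)).
  - move=> x; rewrite /= in_itv/= => /andP[x0 xt]; rewrite normrM ler_wpM2l//.
    by rewrite cM// x0 (le_trans xt).
rewrite -/(conv (fun x => `|a x|) (cst M) t) convC//; last first.
  exact: loc_integrable_bounded (loc_bounded_cst M).
rewrite /conv RintegralZl//; last exact: (loc_integrableP _).1.
rewrite ler_wpM2l//.
have i1 S : mu.-integrable `[0, S] (fun x => `|a x|%:E) by exact: (loc_integrableP _).1.
rewrite /Rintegral fine_le//; [exact: integrable_fin_num..|].
apply: ge0_subset_integral => //.
- exact: measurable_int (i1 T).
- by move=> x; rewrite /= !in_itv/= => /andP[-> /le_trans]; exact.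
Qed.

End convolution_algebra.

(** * Primitives and absolute continuity *)

Section ae_eq_integral_nonmeasurable.
Local Open Scope ereal_scope.
Context d (T : measurableType d) (R : realType).
Variable mu : {measure set T -> \bar R}.
Implicit Types (D : set T) (f g : T -> \bar R).

Import HBNNSimple.

Let ge0_ae_eq f g : (forall x, 0 <= f x) -> (forall x, 0 <= g x) ->
  measurable_fun setT g -> {ae mu, forall x, f x = g x} ->
  \int[mu]_x f x = \int[mu]_x g x.
Proof.
move=> f0 g0 mg [N [mN N0 fgN]].
have fgE x : ~ N x -> f x = g x by apply: contra_notP => fg; exact: fgN.
have mNC : measurable (~` N) by exact: measurableC.
apply/eqP; rewrite eq_le; apply/andP; split.
  rewrite ge0_integralTE//; apply: ge_ereal_sup => _ [h /= hf <-].
  rewrite -integralT_nnsfun.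
  have mh : measurable_fun setT (EFin \o h) by exact/measurable_EFinP.
  rewrite (@ge0_negligible_integral _ _ _ mu setT N)//; last first.
    by move=> x _; rewrite lee_fin.
  rewrite [leRHS](@ge0_negligible_integral _ _ _ mu setT N)//.
  apply: ge0_le_integral => //.
  - by rewrite setTD.
  - by move=> x _; rewrite lee_fin.
  - exact: measurable_funTS.
  - exact: measurable_funTS.
  - by move=> x [_ /fgE <-].
rewrite (@ge0_negligible_integral _ _ _ mu setT N)// setTD integral_mkcond.
have gN0 x : 0 <= (g \_ (~` N)) x by rewrite patchE; case: ifPn.
rewrite !ge0_integralTE//; apply: le_ereal_sup => _ [h /= hg <-]; exists h => //.
move=> x /=; rewrite (le_trans (hg x))// patchE; case: ifPn => [|//].
by rewrite inE => /fgE ->.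
Qed.

(** For f built from derive1, whose values are arbitrary where the derivative does
not exist: the integral of a nonnegative function is a supremum over simple
functions, and these may be cut off on the exceptional null set. *)
Lemma ae_eq_integral_left D f g : measurable D -> measurable_fun D g ->
  {ae mu, forall x, D x -> f x = g x} ->
  \int[mu]_(x in D) f x = \int[mu]_(x in D) g x.
Proof.
move=> mD mg fg; rewrite integralE [RHS]integralE.
have {}fg : {ae mu, forall x, (f \_ D) x = (g \_ D) x}.
  by apply: filterS fg => x fg; rewrite !patchE; case: ifPn => // /set_mem/fg.
have {}mg : measurable_fun setT (g \_ D) by exact/(measurable_restrictT _ _).1.
congr (_ - _); rewrite integral_mkcond [RHS]integral_mkcond.
- rewrite -!funepos_restrict; apply: ge0_ae_eq => //.
  + exact: measurable_funepos.
  + by apply: filterS fg => x fg; rewrite !funeposE fg.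
- rewrite -!funeneg_restrict; apply: ge0_ae_eq => //.
  + exact: measurable_funeneg.
  + by apply: filterS fg => x fg; rewrite !funenegE fg.
Qed.

End ae_eq_integral_nonmeasurable.

Section absolute_continuity.
Context {R : realType}.
Notation mu := (@lebesgue_measure R).
Implicit Types a b c f g h : R -> R.

Lemma measurable_loc_integrable h : loc_integrable h ->
  measurable_fun (`[0, +oo[%classic : set R) h.
Proof.
move=> /loc_integrableP lh; rewrite (_ : `[0, +oo[%classic = \bigcup_n `[0, n%:R]%classic).
  apply/measurable_fun_bigcup => // n.
  by apply/measurable_EFinP; exact: measurable_int (lh n%:R).
apply/seteqP; split=> [x|x [n _]] /=; rewrite !in_itv/= ?andbT; last by case/andP.
move=> x0; exists (Num.truncn x).+1 => //=; rewrite in_itv/= x0/= ltW//.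
exact: truncnS_gt.
Qed.

(** The Lebesgue differentiation theorem, for h extended by 0 to the left of 0. *)
Lemma primitive_derive_ae h : loc_integrable h -> {ae mu, forall x : R, 0 < x ->
  derivable (fun t : R => \int[mu]_(y in `[0, t]) h y) x 1 /\
  derive1 (fun t : R => \int[mu]_(y in `[0, t]) h y) x = h x}.
Proof.
move=> lh; have /loc_integrableP lh' := lh.
pose h0 := h \_ (`[0, +oo[%classic : set R).
have h0E x : 0 <= x -> h0 x = h x.
  by move=> x0; rewrite /h0 patchE mem_set//= in_itv/= x0.
have ih0 y : mu.-integrable `[0, y] (EFin \o h0).
  apply: (@eq_integrable _ _ _ mu _ _ (EFin \o h)) => // x.
  by rewrite inE/= in_itv/= => /andP[x0 _]; rewrite h0E.
have mh0 : measurable_fun setT h0.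
  apply/(measurable_restrictT _ _).1 => //; exact: measurable_loc_integrable.
have locf : locally_integrable [set: R] h0.
  split=> [//||K _ cK]; first exact: openT.
  have [M [Mreal KM]] := compact_bounded cK.
  have {}KM x : K x -> `|x| <= M + 1 by apply: KM; rewrite ltrDl.
  have i2 := ih0 (M + 1); have /integrableP[_] := i2; apply: le_lt_trans.
  have mK : measurable K by exact: compact_measurable.
  rewrite integral_mkcond [leRHS]integral_mkcond.
  apply: ge0_le_integral => //.
  - by move=> x _; rewrite patchE; case: ifPn.
  - apply/(measurable_restrictT _ _).1 => //; apply: measurable_funTS.
    by apply/measurable_EFinP; exact: measurableT_comp.
  - apply/(measurable_restrictT _ _).1 => //; apply: measurable_funTS.
    by apply/measurable_EFinP; exact: measurableT_comp.
  - move=> x _; rewrite !patchE; case: ifPn => [|_]; last first.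
    by case: ifPn => _; rewrite ?lexx// abse_ge0.
    move=> /set_mem/KM xM; case: ifPn => //=.
    have [x0|x0 _] := leP 0 x; last first.
      by rewrite /h0 patchE memNset ?normr0//= in_itv/= andbT; apply/negP; rewrite -ltNge.
    by rewrite notin_setE/= in_itv/= x0/= => /negP; rewrite (le_trans (ler_norm x)).
have := @FTC1 _ h0 (BLeft 0) ih0 locf.
have -> : (fun x : R => \int[mu]_(t in [set` Interval (BLeft 0) (BRight x)]) h0 t) =
    (fun x : R => \int[mu]_(t in `[0, x]) h t).
  apply/funext => x; apply: eq_Rintegral => y.
  by rewrite inE/= in_itv/= => /andP[y0 _]; rewrite h0E.
apply: filterS; first exact: (ae_filter_ringOfSetsType mu).
by move=> x H x0; have := H x0; rewrite h0E// ltW.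
Qed.

End absolute_continuity.

#[local] Instance ae_lebesgue_filter {R : realType} :
  Filter (almost_everywhere (@lebesgue_measure R)) :=
  ae_filter_ringOfSetsType _.

Section absolute_continuity_theory.
Context {R : realType}.
Notation mu := (@lebesgue_measure R).
Implicit Types a b c f g h : R -> R.

Lemma ae_neq (y : R) : {ae mu, forall x : R, x != y}.
Proof.
exists [set y]; split => //; first exact: lebesgue_measure_set1.
by move=> x /= /negP; rewrite negbK => /eqP.
Qed.

Lemma ae_gt0W (Q : R -> Prop) : {ae mu, forall x : R, 0 < x -> Q x} ->
  {ae mu, forall x : R, 0 <= x -> Q x}.
Proof.
apply: filterS2 (ae_neq 0) => x x0 Qx xge0.
by apply: Qx; rewrite lt_neqAle eq_sym x0.
Qed.

(** Almost everywhere both functions are the derivative of the common primitive. *)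
Lemma loc_integrable_ae_eq a b : loc_integrable a -> loc_integrable b ->
  (forall t, 0 <= t -> conv (cst 1) a t = conv (cst 1) b t) ->
  {ae mu, forall x : R, 0 <= x -> a x = b x}.
Proof.
move=> la lb ab.
have E : (fun t : R => \int[mu]_(y in `[0, t]) a y) =
         (fun t : R => \int[mu]_(y in `[0, t]) b y).
  apply/funext => t; have [t0|t0] := leP 0 t; last first.
    by rewrite set_itv_ge ?bnd_simp -?ltNge// !Rintegral_set0.
  by have := ab t t0; rewrite !conv1E.
have := primitive_derive_ae lb; rewrite -E.
move=> bE; apply: ae_gt0W; apply: filterS2 (primitive_derive_ae la) bE.
by move=> x aE bE x0; rewrite -(aE x0).2 -(bE x0).2.
Qed.

Lemma conv_ae_eq c a a' : loc_integrable c -> loc_integrable a -> loc_integrable a' ->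
  {ae mu, forall x : R, 0 <= x -> a x = a' x} -> conv c a = conv c a'.
Proof.
move=> lc la la' aa'; apply/funext => t; rewrite /conv /Rintegral; congr fine.
have mc : measurable_fun `[0, t] (fun x => c (t - x)).
  by apply/measurable_EFinP; exact: measurable_int (integrable_reflect t lc).
have mf f : loc_integrable f -> measurable_fun `[0, t] (fun x => (c (t - x) * f x)%:E).
  move=> /loc_integrableP/(_ t)/measurable_int/measurable_EFinP mf.
  by apply/measurable_EFinP; exact: measurable_funM.
apply: ae_eq_integral => //; [exact: mf..|].
by apply: filterS aa' => x E; rewrite /= in_itv/= => /andP[/E ->].
Qed.

Lemma conv_congr a a' b b' :
  (forall x, 0 <= x -> a x = a' x) -> (forall x, 0 <= x -> b x = b' x) ->
  conv a b = conv a' b'.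
Proof.
move=> aa' bb'; apply/funext => t; apply: eq_Rintegral => x.
by rewrite inE/= in_itv/= => /andP[x0 xt]; rewrite aa' ?subr_ge0// bb'.
Qed.

Lemma loc_integrable_congr a a' : (forall x, 0 <= x -> a x = a' x) ->
  loc_integrable a -> loc_integrable a'.
Proof.
move=> aa' la T T0; apply: eq_integrable (la T T0) => // x.
by rewrite inE/= in_itv/= => /andP[x0 xt]; rewrite aa'.
Qed.

Lemma loc_bounded_congr a a' : (forall x, 0 <= x -> a x = a' x) ->
  loc_bounded a -> loc_bounded a'.
Proof.
move=> aa' ba T T0; have [ma [M aM]] := ba T T0; split.
  apply: eq_measurable_fun ma => x.
  by rewrite inE/= in_itv/= => /andP[x0 _]; rewrite aa'.
by exists M => x /andP[x0 xT]; rewrite -aa'// aM// x0.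
Qed.

Lemma locally_ACP f : locally_AC f <->
  exists2 h, loc_integrable h & forall t, 0 <= t -> f t = f 0 + conv (cst 1) h t.
Proof.
split=> [[h [lh fE]]|[h lh fE]]; exists h => //.
  by move=> t t0; rewrite conv1E// fE.
by split=> // t t0; rewrite -conv1E// fE.
Qed.

Lemma conv_at0 a b : conv a b 0 = 0.
Proof. by rewrite /conv set_itv1 Rintegral_set1. Qed.

Lemma locally_AC_cst (k : R) : locally_AC (cst k : R -> R).
Proof.
apply/locally_ACP; exists (cst 0) => [|t t0].
  exact: loc_integrable_bounded (loc_bounded_cst 0).
by rewrite conv1E ?Rintegral_cst ?mul0r ?addr0//; exact: loc_integrable_bounded (loc_bounded_cst 0).
Qed.

Lemma locally_AC_bounded f : locally_AC f -> loc_bounded f.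
Proof.
move=> /locally_ACP[h lh fE].
apply: (@loc_bounded_congr (cst (f 0) + conv h (cst 1))).
  move=> t t0; rewrite (fE t)// convC//.
  exact: loc_integrable_bounded (loc_bounded_cst 1).
apply: loc_boundedD; first exact: loc_bounded_cst.
exact: loc_bounded_conv lh (loc_bounded_cst 1).
Qed.

Lemma locally_AC_primitive h : loc_integrable h -> locally_AC (conv (cst 1) h).
Proof.
by move=> lh; apply/locally_ACP; exists h => // t t0; rewrite conv_at0 add0r.
Qed.

Lemma locally_AC_D f g : locally_AC f -> locally_AC g -> locally_AC (f + g).
Proof.
move=> /locally_ACP[h lh fE] /locally_ACP[h' lh' gE]; apply/locally_ACP.
exists (h + h') => [|t t0]; first exact: loc_integrableD.
have b1 := loc_bounded_cst (1 : R); have l1 := loc_integrable_bounded b1.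
rewrite (convC l1 (loc_integrableD lh lh')) convDl// -!(convC l1)//.
rewrite -[LHS]/(f t + g t) (fE t)// (gE t)//.
rewrite -[RHS]/(f 0 + g 0 + (conv (cst 1) h t + conv (cst 1) h' t)).
by rewrite addrACA.
Qed.

Lemma locally_AC_Z k f : locally_AC f -> locally_AC (k *: f).
Proof.
move=> /locally_ACP[h lh fE]; apply/locally_ACP.
exists (k *: h) => [|t t0]; first exact: loc_integrableZ.
have b1 := loc_bounded_cst (1 : R); have l1 := loc_integrable_bounded b1.
rewrite (convC l1 (loc_integrableZ _ lh)) convZl// -!(convC l1)//.
rewrite -[LHS]/(k * f t) (fE t)//.
by rewrite -[RHS]/(k * f 0 + k * conv (cst 1) h t) mulrDr.
Qed.

(** If f = f(0) + h * 1, then a * f = (f(0) a + a * h) * 1 by associativity. *)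
Lemma locally_AC_conv a f : loc_integrable a -> locally_AC f -> locally_AC (conv a f).
Proof.
move=> la /locally_ACP[h lh fE].
have b1 := loc_bounded_cst (1 : R); have l1 := loc_integrable_bounded b1.
have bh : loc_bounded (conv h (cst 1)) by exact: loc_bounded_conv.
have -> : conv a f = conv (cst 1) (f 0 *: a + conv a h).
  transitivity (conv a (f 0 *: cst 1 + conv h (cst 1))).
    apply: conv_congr => // x x0; rewrite (fE x)// convC//.
    by rewrite -[RHS]/(f 0 * 1 + conv h (cst 1) x) mulr1.
  rewrite (convC l1); last first.
    by apply: loc_integrableD; [exact: loc_integrableZ|exact: loc_integrable_conv].
  rewrite convDl//; [|exact: loc_integrableZ|exact: loc_integrable_conv].
  rewrite convDr//; last exact: loc_boundedZ.
  by rewrite convA// convZl// convZr.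
by apply: locally_AC_primitive; apply: loc_integrableD;
  [exact: loc_integrableZ|exact: loc_integrable_conv].
Qed.

Let within_continuous f : locally_AC f -> forall T, 0 < T ->
  {within `[0, T], continuous f}.
Proof.
move=> /locally_ACP[h lh fE] T T0.
have cp := parameterized_integral_continuous (ltW T0) (lh T (ltW T0)).
have cc : {within `[0, T], continuous
    (fun x => f 0 + parameterized_integral mu 0 x h)}.
  by move=> x; apply: cvgD; [exact: cvg_cst|exact: cp].
apply: (subspace_eq_continuous _ cc) => x.
rewrite inE/= in_itv/= => /andP[x0 _].
by have := fE x x0; rewrite conv1E// => E; exact: esym E.
Qed.

Lemma locally_AC_continuous f t : locally_AC f -> 0 < t ->
  {for t, continuous f}.
Proof.
move=> /within_continuous fc t0.
have tt : 0 < t + 1 by rewrite ltr_wpDr.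
have [+ _ _] := (continuous_within_itvP _ tt).1 (fc _ tt).
by apply; rewrite in_itv/= t0 ltrDl ltr01.
Qed.

Lemma locally_AC_cvg0 f : locally_AC f -> f t @[t --> 0^'+] --> f 0.
Proof.
move=> /within_continuous fc.
by have [_ + _] := (continuous_within_itvP _ (@ltr01 R)).1 (fc _ ltr01).
Qed.

Lemma locally_AC_eq0 f g : locally_AC f -> locally_AC g ->
  (forall t, 0 < t -> f t = g t) -> f 0 = g 0.
Proof.
move=> /locally_AC_cvg0 cf /locally_AC_cvg0 cg fg.
apply: (@cvg_unique _ _ (f t @[t --> 0^'+])) => //.
apply: cvg_trans cg; apply: near_eq_cvg.
by near=> t; rewrite fg//; near: t; exact: nbhs_right_gt.
Unshelve. all: by end_near. Qed.

Lemma locally_AC_derive f : locally_AC f -> exists h, [/\ loc_integrable h,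
  (forall t, 0 <= t -> f t = f 0 + conv (cst 1) h t) &
  {ae mu, forall x : R, 0 <= x -> derive1 f x = h x}].
Proof.
move=> /locally_ACP[h lh fE]; exists h; split => //.
apply: ae_gt0W; apply: filterS (primitive_derive_ae lh) => x hE x_gt0.
have [dP <-] := hE x_gt0.
rewrite !derive1E.
transitivity ('D_1 (fun t : R => f 0 + \int[mu]_(y in `[0, t]) h y) x).
  apply: near_eq_derive; near=> t.
  have t0 : 0 < t by near: t; exact: lt_nbhsr.
  by rewrite (fE t (ltW t0)) conv1E.
by rewrite deriveD// derive_cst add0r.
Unshelve. all: by end_near. Qed.

End absolute_continuity_theory.

(** * Laplace-transformable functions *)

Section laplace.
Context {R : realType}.
Notation mu := (@lebesgue_measure R).
Implicit Types a b c f g h : R -> R.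

Lemma integral_expR (k : R) : 0 < k ->
  (\int[mu]_(t in `[0%R, +oo[) (expR (- (k * t)))%:E = (k^-1)%:E)%E.
Proof.
move=> k0; pose F x := - (k^-1 * expR (- (k * x))).
have dF (x : R) : is_derive x 1 F (expR (- (k * x))).
  apply: is_derive_eq; rewrite /GRing.scale /= !mulr1.
  by field; rewrite gt_eqF.
rewrite (@ge0_continuous_FTC2y _ _ F 0 0)//.
- by rewrite -EFinB /F mulr0 oppr0 expR0 mulr1 sub0r opprK.
- apply: continuous_subspaceT => x; apply: continuous_comp; last exact: continuous_expR.
  by apply: cvgN; apply: cvgM; [exact: cvg_cst|exact: cvg_id].
- rewrite -oppr0; apply: cvgN; rewrite -(mulr0 k^-1); apply: cvgM.
    exact: cvg_cst.
  apply: (cvg_comp (fun x => k * x) (fun x => expR (- x))); last exact: cvgr_expR.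
  exact: gt0_cvgMry.
- apply/cvg_at_right_filter; apply: differentiable_continuous.
  by apply/derivable1_diffP; exact: ex_derive.
- by move=> x _; rewrite derive1E; exact: derive_val.
Qed.

Lemma integrable_expR (k : R) : 0 < k ->
  mu.-integrable `[0, +oo[ (fun t => (expR (- (k * t)))%:E).
Proof.
move=> k0; apply/integrableP; split.
  apply/measurable_EFinP; apply: measurableT_comp => //.
  by apply: measurable_funN; exact: measurable_funM.
under eq_integral => x _ do rewrite abse_EFin ger0_norm ?expR_ge0//.
by rewrite integral_expR// ltry.
Qed.

Lemma laplace_loc_integrable f : laplace_transformable f -> loc_integrable f.
Proof.
move=> [s lf] T T0.
have -> : (fun x => (f x)%:E) = (fun x => (expR (- (s * x)) * f x * expR (s * x))%:E).
  by apply/funext => x; rewrite mulrAC -expRD addNr expR0 mul1r.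
apply: (@integrableM_bounded _ _ _ _ (expR (`|s| * T))) => //.
- apply: integrableS lf => //.
  by move=> t /=; rewrite !in_itv/= => /andP[->].
- by apply: measurableT_comp => //; exact: measurable_funM.
- move=> x /=; rewrite in_itv/= => /andP[x0 xT].
  rewrite ger0_norm ?expR_ge0// ler_expR (le_trans (ler_norm _))//.
  by rewrite normrM ler_wpM2l// ger0_norm.
Qed.

Let measurable_expRZ (s : R) (D : set R) :
  measurable_fun D (fun t : R => expR (- (s * t))).
Proof.
apply: measurable_funTS; apply: measurableT_comp => //.
by apply: measurable_funN; exact: measurable_funM.
Qed.

Lemma laplace_le f (s s' : R) : s <= s' ->
  mu.-integrable `[0, +oo[ (fun t => (expR (- (s * t)) * f t)%:E) ->
  mu.-integrable `[0, +oo[ (fun t => (expR (- (s' * t)) * f t)%:E).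
Proof.
move=> ss' lf; have mlf := measurable_int mu lf.
apply: le_integrable lf => //.
- rewrite (_ : (fun t => _) = (fun t => (expR (- ((s' - s) * t)) *
      (expR (- (s * t)) * f t))%:E)); last first.
    apply/funext => t; rewrite mulrA -expRD; congr (expR _ * _)%:E.
    by rewrite -opprD -mulrDl subrK.
  apply/measurable_EFinP; apply: measurable_funM; last exact/measurable_EFinP.
  exact: measurable_expRZ.
- move=> t /=; rewrite in_itv/= andbT => t0.
  by rewrite lee_fin !normrM ler_wpM2r// !ger0_norm ?expR_ge0// ler_expR lerN2 ler_wpM2r.
Qed.

Lemma laplace_transformableD f g : laplace_transformable f ->
  laplace_transformable g -> laplace_transformable (f + g).
Proof.
move=> [s lf] [s' lg]; exists (Num.max s s').
have ms : s <= Num.max s s' by rewrite le_max lexx.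
have ms' : s' <= Num.max s s' by rewrite le_max lexx orbT.
have {}lf := laplace_le ms lf; have {}lg := laplace_le ms' lg.
have := @integrableD _ _ _ mu _ (measurable_itv _) _ _ lf lg.
apply: eq_integrable => // t _.
by rewrite -[(f + g) t]/(f t + g t) mulrDr.
Qed.

Lemma laplace_transformableZ k f : laplace_transformable f ->
  laplace_transformable (k *: f).
Proof.
move=> [s lf]; exists s; have := @integrableZl _ _ _ mu _ (measurable_itv _) k _ lf.
apply: eq_integrable => // t _.
by rewrite -[(k *: f) t]/(k * f t) mulrCA.
Qed.

Lemma laplace_transformable_cst (k : R) : laplace_transformable (cst k : R -> R).
Proof.
exists 1; have := @integrableZl _ _ _ mu _ (measurable_itv _) k _ (integrable_expR ltr01).
by apply: eq_integrable => // t _ /=; rewrite -EFinM mulrC.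
Qed.

Lemma laplace_transformable_bound f (C w : R) : loc_integrable f ->
  (forall t, 1 <= t -> `|f t| <= C * expR (w * t)) -> laplace_transformable f.
Proof.
move=> lf fC; exists (w + 1).
have mf := measurable_loc_integrable lf.
have i1 : mu.-integrable `[0, +oo[
    ((fun t => (f t * expR (- ((w + 1) * t)))%:E) \_ `[0, 1]).
  apply/integrable_restrict => //; rewrite setIidr; last first.
    by move=> t /=; rewrite !in_itv/= => /andP[->].
  apply: (@integrableM_bounded _ _ f (fun t => expR (- ((w + 1) * t)))
    (expR `|w + 1|)) => //.
  - by apply: lf.
  - move=> x /=; rewrite in_itv/= => /andP[x0 x1].
    rewrite ger0_norm ?expR_ge0// ler_expR (le_trans (ler_norm _))//.
    by rewrite normrN normrM [`|x|]ger0_norm// ler_piMr.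
have i2 := @integrableZl _ _ _ mu _ (measurable_itv _) C _ (integrable_expR ltr01).
have C0 : 0 <= C.
  have := le_trans (normr_ge0 _) (fC 1 (lexx _)).
  by rewrite pmulr_lge0// expR_gt0.
have i3 := @integrableD _ _ _ mu _ (measurable_itv _) _ _ (integrable_abse i1) i2.
apply: le_integrable i3 => //.
  by apply/measurable_EFinP; apply: measurable_funM => //; exact: measurable_expRZ.
move=> t /=; rewrite in_itv/= andbT => t0.
rewrite patchE mul1r; have [t1|t1] := leP t 1.
  rewrite mem_set/=; last by rewrite in_itv/= t0.
  rewrite mulrC lee_fin [leRHS]ger0_norm ?lerDl ?mulr_ge0 ?expR_ge0// addr_ge0//.
  by rewrite mulr_ge0 ?expR_ge0.
rewrite memNset/=; last by rewrite in_itv/= t0/= leNgt t1.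
rewrite normr0 add0r/= normrM [`|expR _|]ger0_norm ?expR_ge0//.
rewrite lee_fin [leRHS]ger0_norm ?mulr_ge0 ?expR_ge0//.
apply: (le_trans (ler_wpM2l (expR_ge0 _) (fC t (ltW t1)))).
by rewrite mulrCA -expRD mulrDl mul1r opprD addrAC addNr add0r.
Qed.

(** With a weight e^(- s t) on both factors the convolution gets the same weight,
and Tonelli bounds its integral by the product of the two Laplace integrals. *)
Lemma laplace_transformable_conv a b : laplace_transformable a ->
  laplace_transformable b -> laplace_transformable (conv a b).
Proof.
move=> [s1 la1] [s2 lb2].
have la : loc_integrable a by apply: laplace_loc_integrable; exists s1.
have lb : loc_integrable b by apply: laplace_loc_integrable; exists s2.
pose s := Num.max s1 s2; exists s.
have ms1 : s1 <= s by rewrite le_max lexx.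
have ms2 : s2 <= s by rewrite le_max lexx orbT.
have {}la1 := laplace_le ms1 la1.
have {}lb2 := laplace_le ms2 lb2.
have lab := measurable_loc_integrable (loc_integrable_conv la lb).
pose D : set R := `[0, +oo[%classic.
pose F := (fun t => expR (- (s * t)) * a t) \_ D.
pose G := (fun t => expR (- (s * t)) * b t) \_ D.
have iF : mu.-integrable setT (EFin \o F).
  by have /integrable_mkcond := la1; rewrite -restrict_EFin; exact.
have iG : mu.-integrable setT (EFin \o G).
  by have /integrable_mkcond := lb2; rewrite -restrict_EFin; exact.
pose K := fun z : R * R => (G z.2 * F (1 * z.1 + -1 * z.2))%:E.
have iK : (mu \x mu)%E.-integrable setT K.
  by apply: integrable_kernel21; rewrite ?normr1.
have [mK _] := integrableP _ _ _ iK.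
have mAK : measurable_fun setT (abse \o K) by exact: measurableT_comp.
have := (@integrable12ltyP _ _ _ _ R mu mu _ mK).1 iK => fub.
have mexp := @measurable_expRZ s D.
apply/integrableP; split.
  by apply/measurable_EFinP; exact: measurable_funM.
apply: le_lt_trans fub; rewrite integral_mkcond.
apply: ge0_le_integral => //.
- by move=> x _; apply: erestrict_ge0 => y _; exact: abse_ge0.
- apply/(measurable_restrictT _ _).1 => //.
  apply/measurable_EFinP; apply: measurableT_comp => //.
  exact: measurable_funM.
- have := @measurable_fun_fubini_tonelli_F _ _ _ _ R mu (abse \o K).
  by apply => // z; exact: abse_ge0.
move=> x _; rewrite patchE; case: ifPn => [/set_mem|_]; last exact: integral_ge0.
rewrite /= in_itv/= andbT => x0.
have mab : measurable_fun `[0, x] (fun y => (a (x - y) * b y)%:E).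
  apply/measurable_EFinP; apply: measurable_funM.
    by apply/measurable_EFinP; exact: measurable_int (integrable_reflect x la).
  by apply/measurable_EFinP; exact: measurable_int (lb x x0).
rewrite normrM EFinM ger0_norm ?expR_ge0//.
apply: (@le_trans _ _ ((expR (- (s * x)))%:E *
    \int[mu]_(y in `[0%R, x]) `|(a (x - y) * b y)%R%:E|)%E).
  rewrite lee_wpmul2l// ?lee_fin ?expR_ge0//.
  apply: le_trans (le_abse_integral mu _ mab) => //.
  rewrite /conv /Rintegral.
  by case: (integral _ _ _) => [r| |] /=; rewrite ?normr0 ?lexx ?leey.
rewrite -ge0_integralZl//; last exact: measurableT_comp.
rewrite integral_mkcond; apply: ge0_le_integral => //.
- move=> y _; apply: erestrict_ge0 => z _.
  by rewrite mule_ge0 ?abse_ge0// lee_fin expR_ge0.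
- apply/(measurable_restrictT _ _).1 => //; apply: emeasurable_funM => //.
  exact: measurableT_comp.
- exact: (measurableT_comp mAK (pair1_measurable x)).
move=> y _; rewrite patchE; case: ifPn => [/set_mem|_]; last first.
  by rewrite /= lee_fin.
rewrite /= in_itv/= => /andP[y0 yx].
rewrite /G /F !patchE !mem_set/=;
  try by rewrite /D/= in_itv/= ?mul1r ?mulN1r ?subr_ge0 ?yx ?y0.
rewrite -EFinM lee_fin mul1r mulN1r !normrM !(ger0_norm (expR_ge0 _)).
rewrite mulrACA -expRD -opprD -mulrDr (addrC y) subrK.
by rewrite (mulrC `|b y|).
Qed.

End laplace.

(** * The gamma function and the beta integral *)

Section gamma.
Context {R : realType}.
Notation mu := (@lebesgue_measure R).

Lemma continuous_powR (c x : R) : 0 < x -> {for x, continuous (@powR R ^~ c)}.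
Proof.
move=> x0; apply: differentiable_continuous; apply/derivable1_diffP.
by apply: derivable_powR; rewrite in_itv/= andbT.
Qed.

Let integral_powR_le (a e T : R) : 0 < a -> 0 < e -> e <= T ->
  (\int[mu]_(x in `[e, T]) (x `^ (a - 1))%:E <= (a^-1 * T `^ a)%:E)%E.
Proof.
move=> a0 e0; rewrite le_eqVlt => /predU1P[<-|eT].
  rewrite set_itv1 integral_set1 lee_fin mulr_ge0 ?powR_ge0//.
  by rewrite invr_ge0 ltW.
pose F (x : R) := a^-1 * x `^ a.
have dF (x : R) : 0 < x -> is_derive x 1 F (x `^ (a - 1)).
  move=> x0; have dp := is_derive1_powR a x0.
  have := is_deriveZ a^-1 dp.
  by rewrite /GRing.scale/= mulrA mulVf ?gt_eqF// mul1r.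
have cF (x : R) : 0 < x -> {for x, continuous F}.
  move=> /dF dFx; apply: differentiable_continuous.
  by apply/derivable1_diffP; exact: ex_derive.
have T0 := lt_trans e0 eT.
rewrite (@continuous_FTC2 _ (fun x => x `^ (a - 1)) F)//.
- by rewrite -EFinB lee_fin /F lerBlDr lerDl mulr_ge0 ?powR_ge0// invr_ge0 ltW.
- apply: (@continuous_in_subspaceT _ _ `[e, T]%classic) => x.
  by rewrite inE/= in_itv/= => /andP[ex _]; apply: continuous_powR; exact: lt_le_trans ex.
- split.
  + move=> x; rewrite in_itv/= => /andP[ex _].
    by have := dF x (lt_trans e0 ex); case.
  + by apply/cvg_at_right_filter; exact: cF.
  + by apply/cvg_at_left_filter; exact: cF.
- move=> x; rewrite in_itv/= => /andP[ex _]; rewrite derive1E.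
  by have dFx := dF x (lt_trans e0 ex); rewrite derive_val.
Qed.

Let bigcup_itv (T : R) : 0 < T ->
  \bigcup_n `[T / n.+1%:R, T]%classic = `]0, T]%classic :> set R.
Proof.
move=> T0; apply/seteqP; split=> [x [n _]|x] /=.
  rewrite !in_itv/= => /andP[h ->].
  by rewrite andbT (lt_le_trans _ h)// divr_gt0.
rewrite in_itv/= => /andP[x0 xT].
exists (Num.truncn (T / x)) => //=; rewrite in_itv/= xT andbT.
rewrite ler_pdivrMr// mulrC -ler_pdivrMr// ltW//.
exact: truncnS_gt.
Qed.

(** The antiderivative x^a / a bounds the integrals over [T/(n+1), T] by T^a / a;
monotone convergence extends the bound to ]0, T]. *)
Lemma loc_integrable_powR (a : R) : 0 < a -> loc_integrable (fun x : R => x `^ (a - 1)).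
Proof.
move=> a0 T; rewrite le_eqVlt => /predU1P[<-|T0].
  rewrite set_itv1; apply/integrableP; split; first exact: measurable_fun_set1.
  by rewrite integral_set1.
apply/integrableP; split.
  by apply/measurable_EFinP; exact: measurable_funTS.
under eq_integral => x _ do rewrite abse_EFin ger0_norm ?powR_ge0//.
rewrite -integral_itv_obnd_cbnd; last first.
  by apply/measurable_EFinP; exact: measurable_funTS.
rewrite -(bigcup_itv T0).
apply: (@le_lt_trans _ _ (a^-1 * T `^ a)%:E); last exact: ltry.
set F := fun n => `[T / n.+1%:R, T]%classic : set R.
have cvI : (\int[mu]_(x in F i) (x `^ (a - 1))%:E @[i --> \oo] -->
    \int[mu]_(x in \bigcup_i F i) (x `^ (a - 1))%:E)%E.
  apply: ge0_nondecreasing_set_cvg_integral => //.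
  - move=> m n mn; rewrite subsetEset => x; rewrite /F /= !in_itv/= => /andP[h ->].
    rewrite andbT (le_trans _ h)// ler_pM2l// lef_pV2 ?posrE//.
    by rewrite ler_nat.
  - by move=> n; exact: measurable_itv.
  - by move=> n; apply/measurable_EFinP; exact: measurable_funTS.
  - by move=> n x _; rewrite lee_fin powR_ge0.
rewrite -(cvg_lim _ cvI)//; apply: lime_le; first by apply/cvg_ex; eexists; exact: cvI.
apply: nearW => n; apply: integral_powR_le => //.
  by rewrite divr_gt0.
by rewrite ler_pdivrMr// ler_peMr ?ler1n// ltW.
Qed.

Let gamma_integrand (z x : R) : R := x `^ (z - 1) * expR (- x).

(** Near 0 the power dominates. Beyond 1, with w = |z - 1| + 1, the inequality
ln y < y at y = x / (2 w) gives x^w <= (2 w)^w e^(x/2). *)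
Lemma integrable_gamma (z : R) : 0 < z ->
  mu.-integrable `]0, +oo[ (fun x => (gamma_integrand z x)%:E).
Proof.
move=> z0; set w := `|z - 1| + 1; have w0 : 0 < w by rewrite ltr_wpDl.
pose C := (2 * w) `^ w.
have mg : measurable_fun setT (gamma_integrand z).
  apply: measurable_funM => //; apply: measurableT_comp => //.
have i1 : mu.-integrable `]0, +oo[ ((fun x => (x `^ (z - 1))%:E) \_ `]0, 1]).
  apply/integrable_restrict => //; rewrite setIidr; last first.
    by move=> t /=; rewrite !in_itv/= => /andP[->].
  apply: integrableS (loc_integrable_powR z0 ler01) => //.
  by move=> t /=; rewrite !in_itv/= => /andP[/ltW -> ->].
have i2 : mu.-integrable `]0, +oo[ (fun x => C%:E * (expR (- (2^-1 * x)))%:E)%E.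
  apply: integrableZl => //.
  have h2 : (0 : R) < 2^-1 by rewrite invr_gt0.
  apply: integrableS (integrable_expR h2) => //.
  by move=> t /=; rewrite !in_itv/= !andbT => /ltW.
have i3 := @integrableD _ _ _ mu _ (measurable_itv _) _ _ i1 i2.
apply: le_integrable i3 => //.
  by apply/measurable_EFinP; exact: measurable_funTS.
move=> x /=; rewrite in_itv/= andbT => x0; rewrite /gamma_integrand.
rewrite patchE; have [x1|x1] := leP x 1.
  rewrite mem_set/=; last by rewrite in_itv/= x0.
  rewrite lee_fin !ger0_norm ?addr_ge0 ?mulr_ge0 ?powR_ge0 ?expR_ge0//.
  rewrite -[leLHS]addr0 lerD ?mulr_ge0 ?powR_ge0 ?expR_ge0//.
  rewrite ler_piMr ?powR_ge0// -expR0 ler_expR; lra.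
rewrite memNset/=; last by rewrite in_itv/= x0/= leNgt x1.
rewrite lee_fin add0r !ger0_norm ?mulr_ge0 ?powR_ge0 ?expR_ge0//.
have xw : x `^ (z - 1) <= C * expR (2^-1 * x).
  apply: (@le_trans _ _ (x `^ w)).
    by rewrite ler_powR ?(ltW x1)// (le_trans (ler_norm _))// lerDl.
  rewrite /C /powR !gt_eqF ?mulr_gt0// -expRD ler_expR.
  have w2 : 0 < 2 * w by rewrite mulr_gt0.
  have : ln (x / (2 * w)) < x / (2 * w) by apply: ln_sublinear; rewrite divr_gt0.
  rewrite ln_div ?posrE// => /ltW h.
  have := ler_wpM2l (ltW w0) h; rewrite mulrBr lerBlDl => /le_trans; apply.
  rewrite lerD2l le_eqVlt; apply/orP; left; apply/eqP; field.
  by rewrite gt_eqF.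
apply: (le_trans (ler_wpM2r (expR_ge0 _) xw)).
by rewrite -mulrA -expRD ler_wpM2l ?powR_ge0// ler_expR; lra.
Qed.

(** Keep only the part of the integral over [M, M + 1]. As M is free, 1 / Gamma
along an arithmetic progression decays faster than any geometric sequence, and
M proportional to t gives exponential bounds in t. *)
Lemma Gamma_fun_ge (z M : R) : 0 < z -> 0 < M ->
  M `^ z * (expR (- (M + 1)) / (M + 1)) <= Gamma_fun z.
Proof.
move=> z0 M0; have iG := integrable_gamma z0.
have ? : measurable (`[M, M + 1]%classic : set R) by exact: measurable_itv.
have M10 : 0 < M + 1 by rewrite addr_gt0.
pose D : set R := `[M, M + 1]%classic.
have sub : D `<=` `]0, +oo[%classic.
  by move=> x; rewrite /D/= !in_itv/= andbT => /andP[/(lt_le_trans M0)].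
have iG1 : mu.-integrable D (fun x => (gamma_integrand z x)%:E).
  by apply: integrableS iG.
rewrite -lee_fin /Gamma_fun /Rintegral fineK; last exact: integrable_fin_num.
apply: (@le_trans _ _ (\int[mu]_(x in D) (gamma_integrand z x)%:E)%E); last first.
  apply: ge0_subset_integral => //.
  - exact: measurable_int iG.
  - by move=> x _; rewrite lee_fin mulr_ge0 ?powR_ge0 ?expR_ge0.
set c := M `^ z * _.
have -> : c%:E = (\int[mu]_(x in D) (cst c%:E) x)%E.
  rewrite integral_cst//= /D lebesgue_measure_itv/= lte_fin ltrDl ltr01.
  by rewrite -EFinB -EFinM addrAC subrr add0r mulr1.
apply: ge0_le_integral => //.
- move=> x _; rewrite lee_fin /c !mulr_ge0 ?powR_ge0 ?expR_ge0// invr_ge0 ltW//.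
- exact: measurable_int iG1.
move=> x; rewrite /D/= in_itv/= => /andP[Mx xM]; rewrite lee_fin /gamma_integrand.
have x0 := lt_le_trans M0 Mx.
have -> : x `^ (z - 1) = x `^ z / x.
  by rewrite powRB ?(powRr1 (ltW x0))// (gt_eqF x0) implybT.
rewrite /c -[leRHS]mulrA [x^-1 * _]mulrC; apply: ler_pM.
- exact: powR_ge0.
- by rewrite mulr_ge0 ?expR_ge0// invr_ge0 ltW.
- by apply: ge0_ler_powR; rewrite ?nnegrE// ltW.
apply: ler_pM; rewrite ?expR_ge0 ?invr_ge0 ?(ltW M10)//.
- by rewrite ler_expR lerN2.
- by rewrite lef_pV2 ?posrE.
Qed.

Lemma Gamma_fun_gt0 (z : R) : 0 < z -> 0 < Gamma_fun z.
Proof.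
move=> z0; apply: lt_le_trans (Gamma_fun_ge z0 ltr01).
by rewrite mulr_gt0 ?powR_gt0// divr_gt0 ?expR_gt0.
Qed.

End gamma.

Section beta.
Context {R : realType}.
Notation mu := (@lebesgue_measure R).
Implicit Types a b t : R.

Let mule_cancel (I J : \bar R) (c t : R) : t != 0 ->
  ((c / t)%:E * I = t^-1%:E * J)%E -> (J = c%:E * I)%E.
Proof.
move=> t0 E; have := congr1 (fun x => t%:E * x)%E E.
by rewrite !muleA -!EFinM mulfV// mul1e mulrCA mulfV// mulr1.
Qed.

Let mule_divr (x : \bar R) (g c : R) : (0 <= x)%E -> 0 < g ->
  (x * g%:E = c%:E)%E -> x = (c / g)%:E.
Proof.
case: x => [r| |]//= _ g0; last by rewrite gt0_mulye.
by rewrite -EFinM => -[<-]; rewrite mulfK// gt_eqF.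
Qed.

Let pw a : R -> R := fun x => x `^ (a - 1).

Let measurable_pw a : measurable_fun [set: R] (pw a).
Proof. exact: measurable_powR. Qed.

Let H a b t (y : R) : \bar R :=
  ((fun y => (pw a (t - y) * pw b y)%:E) \_ (`[0%R, t]%classic : set R)) y.

Let H_ge0 a b t y : (0 <= H a b t y)%E.
Proof.
by apply: erestrict_ge0 => x _; rewrite lee_fin mulr_ge0 ?powR_ge0.
Qed.

Let measurable_integrand a b t :
  measurable_fun [set: R] (fun y => (pw a (t - y) * pw b y)%:E).
Proof.
apply/measurable_EFinP; apply: measurable_funM => //.
by apply: (measurableT_comp (measurable_pw a)); exact: measurable_funB.
Qed.

Let measurable_H a b t : measurable_fun [set: R] (H a b t).
Proof.
apply/(measurable_restrictT _ _).1 => //.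
by apply: measurable_funTS; exact: measurable_integrand.
Qed.

(** The substitution y = t u. *)
Let H_scale a b t : 0 < t ->
  (\int[mu]_y H a b t y = (t `^ (a + b - 1))%:E * \int[mu]_y H a b 1 y)%E.
Proof.
move=> t0; have tn0 : t != 0 by rewrite gt_eqF.
have := ge0_integral_affine 0 tn0 (measurable_H a b t) (H_ge0 a b t).
have -> : (\int[mu]_x H a b t (t * x + 0)%R =
    (t `^ (a + b - 1) / t)%:E * \int[mu]_y H a b 1 y)%E.
  rewrite -ge0_integralZl//; [|exact: measurable_H|]; last first.
    by rewrite lee_fin divr_ge0 ?powR_ge0// ltW.
  apply: eq_integral => y _; rewrite /H addr0 !patchE.
  have tyE : (t * y \in (`[0, t]%classic : set R)) = (y \in (`[0, 1]%classic : set R)).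
    apply/idP/idP; rewrite !inE/= !in_itv/= pmulr_rge0// ger_pMr//.
  rewrite tyE; case: ifPn => [|_]; last by rewrite mule0.
  rewrite inE/= in_itv/= => /andP[y0 y1]; rewrite -EFinM; congr EFin.
  have -> : t - t * y = t * (1 - y) by rewrite mulrBr mulr1.
  rewrite /pw powRM ?subr_ge0// ?ltW// (powRM _ (ltW t0) y0).
  have -> : a + b - 1 = (a - 1) + (b - 1) + 1 by lra.
  rewrite (@powRD _ _ _ 1) ?tn0 ?implybT// powRr1 ?ltW// mulfK//.
  rewrite (@powRD _ _ _ (b - 1)) ?tn0 ?implybT//.
  by rewrite mulrACA.
by rewrite (gtr0_norm t0); exact: mule_cancel.
Qed.

Let F a : R -> R :=
  (fun x => pw a x * expR (- x)) \_ (`[0%R, +oo[%classic : set R).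

Let measurable_gi a : measurable_fun [set: R] (fun x => (pw a x * expR (- x))%:E).
Proof.
apply/measurable_EFinP; apply: measurable_funM => //.
exact: measurableT_comp.
Qed.

Let integral_F a : 0 < a ->
  mu.-integrable setT (EFin \o F a) /\ (\int[mu]_x (F a x)%:E = (Gamma_fun a)%:E)%E.
Proof.
move=> a0; have iG := integrable_gamma a0.
have E : (\int[mu]_(x in `[0%R, +oo[) (pw a x * expR (- x))%:E =
    (Gamma_fun a)%:E)%E.
  rewrite -integral_itv_obnd_cbnd; last first.
    by apply: measurable_funTS; exact: measurable_gi.
  by rewrite /Gamma_fun /Rintegral fineK//; exact: integrable_fin_num.
split; last first.
  rewrite -E [RHS]integral_mkcond; apply: eq_integral => x _.
  by rewrite /F !patchE; case: ifPn.
have iD : mu.-integrable `[0, +oo[ (fun x => (pw a x * expR (- x))%:E).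
  apply/integrableP; split; first exact: (measurable_funTS (measurable_gi a)).
  under eq_integral => x _ do
    rewrite abse_EFin ger0_norm ?mulr_ge0 ?powR_ge0 ?expR_ge0//.
  by rewrite E ltry.
by have /integrable_mkcond := iD; rewrite -restrict_EFin; exact.
Qed.

(** Gamma(a) Gamma(b) is the integral of the convolution of x^(a-1) e^(-x) and
x^(b-1) e^(-x). At x this convolution is e^(-x) x^(a+b-1) beta, with beta the
value at t = 1 of the integral in question, so the same integral is also
beta Gamma(a + b). *)
Lemma integral_beta a b t : 0 < a -> 0 < b -> 0 < t ->
  (\int[mu]_(y in `[0%R, t]) ((t - y) `^ (a - 1) * y `^ (b - 1))%:E =
  (Gamma_fun a * Gamma_fun b / Gamma_fun (a + b) * t `^ (a + b - 1))%:E)%E.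
Proof.
move=> a0 b0 t0; have ab0 : 0 < a + b by rewrite addr_gt0.
rewrite integral_mkcond -/(H a b t).
rewrite (H_scale a b t0).
set beta := (\int[mu]_y H a b 1 y)%E.
have beta0 : (0 <= beta)%E by apply: integral_ge0 => x _; exact: H_ge0.
have Gab := Gamma_fun_gt0 ab0.
suff E : (beta * (Gamma_fun (a + b))%:E = (Gamma_fun a * Gamma_fun b)%:E)%E.
  by rewrite (mule_divr beta0 Gab E) -EFinM mulrC.
have [iFa Ea] := integral_F a0; have [iFb Eb] := integral_F b0.
pose K := fun z : R * R => (F b z.2 * F a (1 * z.1 + -1 * z.2))%:E.
have iK : (mu \x mu)%E.-integrable setT K.
  by apply: integrable_kernel21; rewrite ?normr1.
have := @Fubini _ _ _ _ R mu mu K iK.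
have -> : (\int[mu]_y \int[mu]_x K (x, y) = (Gamma_fun a * Gamma_fun b)%:E)%E.
  under eq_integral => y _.
    rewrite /K/=; under eq_integral => x _ do rewrite EFinM mul1r.
    rewrite integralZl//; last first.
      by have := @L1_affine _ _ 1 (-1 * y) (oner_neq0 _) iFa; under eq_fun do rewrite mul1r.
    have -> : (\int[mu]_x (F a (x + -1 * y)%R)%:E = \int[mu]_x (F a x)%:E)%E.
      have := @integral_isometry R 1 (-1 * y) (EFin \o F a).
      rewrite normr1 => /(_ erefl (measurable_int mu iFa)) <-.
      by apply: eq_integral => x _; rewrite /= mul1r.
    rewrite Ea; over.
  by rewrite /= integralZr// Eb -EFinM mulrC.
have Kneg x : x < 0 -> forall y, K (x, y) = 0%E.
  move=> x0 y; rewrite /K /F/= !patchE.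
  case: ifPn => [/set_mem|_]; last by rewrite mul0r.
  rewrite /= in_itv/= andbT => y0.
  case: ifPn => [/set_mem|_]; last by rewrite mulr0.
  rewrite /= in_itv/= andbT => xy; exfalso; lra.
have -> : (\int[mu]_x \int[mu]_y K (x, y) =
    \int[mu]_(x in `]0%R, +oo[) \int[mu]_y K (x, y))%E.
  rewrite integral_itv_obnd_cbnd; last first.
    by apply: measurable_funTS; exact: (@measurable_fubini_F _ _ _ _ R mu mu K iK).
  rewrite [RHS]integral_mkcond; apply: eq_integral => x _; rewrite patchE.
  case: ifPn => // /negP xn; rewrite integral0_eq// => y _.
  by apply: Kneg; rewrite ltNge; apply/negP => x0; apply: xn; rewrite inE/= in_itv/= x0.
have -> : (\int[mu]_(x in `]0%R, +oo[) \int[mu]_y K (x, y) =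
    \int[mu]_(x in `]0%R, +oo[) (beta * (pw (a + b) x * expR (- x))%:E))%E.
  apply: eq_integral => x; rewrite inE/= in_itv/= andbT => x0.
  have -> : (\int[mu]_y K (x, y) = \int[mu]_y ((expR (- x))%:E * H a b x y))%E.
    apply: eq_integral => y _; rewrite /K /F /H /= !patchE mul1r mulN1r.
    have -> : (x - y \in (`[0, +oo[%classic : set R)) = (y <= x).
      by apply/idP/idP; rewrite inE/= in_itv/= andbT subr_ge0.
    have -> : (y \in (`[0, +oo[%classic : set R)) = (0 <= y).
      by apply/idP/idP; rewrite inE/= in_itv/= andbT.
    have -> : (y \in (`[0, x]%classic : set R)) = (0 <= y <= x).
      by apply/idP/idP; rewrite inE/= in_itv/=.
    case: (0 <= y); last by rewrite mul0r mule0.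
    case: (y <= x); last by rewrite mulr0 mule0.
    rewrite /= -EFinM mulrACA -expRD -opprD (addrC y) subrK.
    by rewrite mulrC (mulrC (pw b y)).
  rewrite ge0_integralZl ?lee_fin ?expR_ge0//; last exact: measurable_H.
  by rewrite H_scale// -/beta muleA -EFinM muleC (mulrC (expR _)).
rewrite ge0_integralZl//.
- move=> E; rewrite -E /Gamma_fun /Rintegral fineK//.
  by apply: integrable_fin_num => //; exact: integrable_gamma.
- by apply: measurable_funTS; exact: measurable_gi.
- by move=> x _; rewrite lee_fin mulr_ge0 ?powR_ge0 ?expR_ge0.
Qed.

End beta.

(** * Entire power series *)

Section entire_series.
Context {R : realType}.
Implicit Types (c u : R^nat) (x : R).

Lemma half_series_bound u (C : R) : (forall n, `|u n| <= C * 2^-1 ^+ n) ->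
  [/\ cvgn (series u), (forall N, `|series u N| <= 2 * C) &
      `|limn (series u)| <= 2 * C].
Proof.
move=> uC.
have C0 : 0 <= C by have := le_trans (normr_ge0 _) (uC 0); rewrite expr0 mulr1.
have h1 : (2^-1 : R) != 1 by lra.
have partial N : `|series u N| <= 2 * C.
  rewrite (le_trans (ler_norm_sum _ _ _))//.
  apply: (@le_trans _ _ (series (geometric C 2^-1) N)).
    by rewrite /series/=; apply: ler_sum => i _; exact: uC.
  rewrite geometric_seriesE//= ler_pdivrMr; last lra.
  rewrite mulrAC (_ : 2 * (1 - 2^-1) = 1); last by field.
  rewrite mul1r ler_piMr// lerBlDr lerDl exprn_ge0//.
have cu : cvgn (series u).
  apply: normed_cvg; apply: (@series_le_cvg _ _ (geometric C 2^-1)).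
  - by move=> n; exact: normr_ge0.
  - by move=> n; rewrite /geometric/= mulr_ge0// exprn_ge0.
  - exact: uC.
  - apply/cvg_ex; eexists; apply: cvg_geometric_series.
    by rewrite ger0_norm//; lra.
split => //.
have cn : (fun N => `|series u N|) @ \oo --> `|limn (series u)|.
  by apply: cvg_norm; exact: cu.
rewrite -(cvg_lim _ cn)//; apply: limr_le; first by apply/cvg_ex; eexists; exact: cn.
exact: nearW.
Qed.

(** The coefficients of the power series of an entire function. *)
Definition entire c := forall rho : R, 0 < rho ->
  exists C : R, forall n, `|c n| <= C * rho ^+ n.

Lemma entire_bound c (X : R) : entire c -> exists C : R, forall x, `|x| <= X ->
  forall n, `|c n * x ^+ n| <= C * 2^-1 ^+ n.
Proof.
move=> ec; have X0 : 0 < 2 * (`|X| + 1) by rewrite mulr_gt0// ltr_wpDl.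
have rho0 : 0 < (2 * (`|X| + 1))^-1 by rewrite invr_gt0.
have [C cC] := ec _ rho0.
exists C => x xX n; rewrite normrM normrX.
apply: (@le_trans _ _ (C * (2 * (`|X| + 1))^-1 ^+ n * (`|X| + 1) ^+ n)).
  apply: ler_pM; rewrite ?exprn_ge0//.
  by rewrite lerXn2r ?nnegrE ?addr_ge0// (le_trans xX)// (le_trans (ler_norm _))// lerDl.
rewrite -mulrA -exprMn invfM mulrAC -mulrA mulfV ?mulr1//.

Qed.

Lemma entire_cvg c x : entire c -> cvgn (pseries c x).
Proof.
move=> /(entire_bound `|x|)[C cC].
by have [+ _ _] := half_series_bound (cC x (lexx _)).
Qed.

(** The factor n + 1 <= 2^(n+1) is absorbed by replacing rho by rho / 2. *)
Lemma entire_diffs c : entire c -> entire (pseries_diffs c).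
Proof.
move=> ec rho r0; have r2 : 0 < rho / 2 by rewrite divr_gt0.
have [C cC] := ec _ r2.
have C0 : 0 <= C by have := le_trans (normr_ge0 _) (cC 0); rewrite expr0 mulr1.
exists (C * rho) => n; rewrite /pseries_diffs normrM ger0_norm//.
apply: (@le_trans _ _ (2 ^+ n.+1 * (C * (rho / 2) ^+ n.+1))).
  apply: ler_pM => //; rewrite -natrX ler_nat ltnW//; exact: ltn_expl.
rewrite exprMn mulrCA -mulrA ler_wpM2l// mulrCA -exprMn mulfV// expr1n mulr1.
by rewrite exprS.
Qed.

Lemma entire_continuous c : entire c -> continuous (fun x => limn (pseries c x)).
Proof.
move=> ec x; have ed := entire_diffs ec; have edd := entire_diffs ed.
apply: differentiable_continuous; apply/derivable1_diffP.
have xK : `|x| < `| `|x| + 1 | by rewrite [ltRHS]ger0_norm ?addr_ge0// ltrDl.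
have := pseries_snd_diffs (entire_cvg ec) (entire_cvg ed) (entire_cvg edd) xK.
by move=> H; exact: ex_derive.
Qed.

End entire_series.

(** * Mittag-Leffler kernels *)

Section mittag_leffler_kernel.
Local Opaque Gamma_fun.
Context {R : realType}.
Notation mu := (@lebesgue_measure R).
Implicit Types a b g m t x : R.

(** The kernel p_b of fractional integration of order b. *)
Definition power_kernel b t : R := t `^ (b - 1) / Gamma_fun b.

Definition ml_coef a b (n : nat) : R := (Gamma_fun (a * n%:R + b))^-1.

(** The two-parameter Mittag-Leffler function E_{a,b}. *)
Definition ml2 a b x : R := limn (pseries (ml_coef a b) x).

(** Equal to the sum over n of m^n p_{a n + b}(t), p_b being the power kernel; its
Laplace transform is s^(a-b) / (s^a - m). *)
Definition ml_kernel a b m t : R := t `^ (b - 1) * ml2 a b (m * t `^ a).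

Lemma mittag_lefflerE a x : mittag_leffler a x = ml2 a 1 x.
Proof.
rewrite /mittag_leffler /ml2 /pseries; congr (limn (series _)).
by apply/funext => n; rewrite mulrC.
Qed.

Let arg_gt0 a b n : 0 < a -> 0 < b -> 0 < a * n%:R + b.
Proof. by move=> a0 b0; rewrite ltr_wpDl// mulr_ge0// ltW. Qed.

Lemma ml_coef_le a b (M : R) n : 0 < a -> 0 < b -> 0 < M ->
  `|ml_coef a b n| <=
  (M + 1) * expR (M + 1) * (M `^ b)^-1 * (M `^ a)^-1 ^+ n.
Proof.
move=> a0 b0 M0; have z0 := arg_gt0 n a0 b0.
have M1 : 0 < M + 1 by rewrite addr_gt0.
have G0 := Gamma_fun_gt0 z0.
rewrite /ml_coef ger0_norm; last by rewrite invr_ge0 ltW.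
have := Gamma_fun_ge z0 M0.
rewrite powRD; last by rewrite (gt_eqF M0) implybT.
rewrite powRrM powR_mulrn ?powR_ge0// => h.
rewrite -[leLHS]mul1r ler_pdivrMr//.
apply: (le_trans _ (ler_wpM2l _ h)); last first.
  by rewrite !mulr_ge0 ?exprn_ge0 ?invr_ge0 ?powR_ge0 ?expR_ge0// ltW.
rewrite le_eqVlt; apply/orP; left; apply/eqP.
rewrite expRN exprVn; field.
by rewrite !gt_eqF ?expR_gt0 ?exprn_gt0 ?powR_gt0.
Qed.

(** Take M in the preceding bound such that M^a = 1 / rho. *)
Lemma ml_coef_entire a b : 0 < a -> 0 < b -> entire (ml_coef a b).
Proof.
move=> a0 b0 rho r0; pose M := (rho^-1) `^ (a^-1).
have M0 : 0 < M by rewrite powR_gt0// invr_gt0.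
exists ((M + 1) * expR (M + 1) * (M `^ b)^-1) => n.
have -> : rho = (M `^ a)^-1.
  by rewrite /M -powRrM mulVf ?gt_eqF// powRr1 ?invrK// invr_ge0 ltW.
exact: ml_coef_le.
Qed.

Lemma ml2_le a b x (M : R) : 0 < a -> 0 < b -> 0 < M ->
  `|x| <= M `^ a / 2 ->
  `|ml2 a b x| <= 2 * ((M + 1) * expR (M + 1) * (M `^ b)^-1).
Proof.
move=> a0 b0 M0 xM.
suff h n : `|ml_coef a b n * x ^+ n| <=
    (M + 1) * expR (M + 1) * (M `^ b)^-1 * 2^-1 ^+ n.
  by have [_ _] := half_series_bound h.
rewrite normrM normrX.
apply: (le_trans (ler_wpM2r (exprn_ge0 _ (normr_ge0 _)) (ml_coef_le n a0 b0 M0))).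
rewrite -[leLHS]mulrA -exprMn ler_wpM2l//.
  by rewrite !mulr_ge0 ?invr_ge0 ?powR_ge0 ?expR_ge0// addr_ge0// ltW.
have Ma := powR_gt0 a M0.
rewrite lerXn2r ?nnegrE//; first by rewrite mulr_ge0// invr_ge0 ltW.
by rewrite mulrC ler_pdivrMr// mulrC.
Qed.

Let coefS a b n : ml_coef a b n.+1 = ml_coef a (a + b) n.
Proof. by rewrite /ml_coef -(natr1 n) mulrDr mulr1 addrA. Qed.

Lemma ml2_rec a b x : 0 < a -> 0 < b ->
  ml2 a b x = (Gamma_fun b)^-1 + x * ml2 a (a + b) x.
Proof.
move=> a0 b0; have ab0 : 0 < a + b by rewrite addr_gt0.
have cab := @entire_cvg _ _ x (ml_coef_entire a0 ab0).
rewrite {1}/ml2; apply/cvg_lim => //.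
rewrite -cvg_shiftS /=.
have -> : (fun n => pseries (ml_coef a b) x n.+1) =
    (fun n => (Gamma_fun b)^-1 + x * pseries (ml_coef a (a + b)) x n).
  apply/funext => n; rewrite /pseries /series/= big_nat_recl//=.
  rewrite expr0 mulr1 {1}/ml_coef mulr0 add0r; congr (_ + _).
  rewrite mulr_sumr; apply: eq_bigr => i _.
  by rewrite exprS mulrCA coefS.
by apply: cvgD; [exact: cvg_cst|apply: cvgM; [exact: cvg_cst|exact: cab]].
Qed.

Lemma ml_kernel_rec a b m t : 0 < a -> 0 < b -> 0 < t ->
  ml_kernel a b m t = power_kernel b t + m * ml_kernel a (a + b) m t.
Proof.
move=> a0 b0 t0; rewrite /ml_kernel ml2_rec// mulrDr; congr (_ + _).
have -> : a + b - 1 = b - 1 + a by lra.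
rewrite (@powRD _ _ (b - 1) a); last by rewrite (gt_eqF t0) implybT.
by ring.
Qed.

Lemma continuous_ml2 a b : 0 < a -> 0 < b -> continuous (ml2 a b).
Proof. by move=> a0 b0; exact: entire_continuous (ml_coef_entire a0 b0). Qed.

Lemma continuous_ml_kernel a b m t : 0 < a -> 0 < b -> 0 < t ->
  {for t, continuous (ml_kernel a b m)}.
Proof.
move=> a0 b0 t0; apply: cvgM; first exact: continuous_powR.
apply: (@continuous_comp _ _ _ (fun t => m * t `^ a) (ml2 a b)).
  by apply: cvgM; [exact: cvg_cst|exact: continuous_powR].
exact: continuous_ml2.
Qed.

Lemma measurable_ml_kernel a b m : 0 < a -> 0 < b ->
  measurable_fun [set: R] (ml_kernel a b m).
Proof.
move=> a0 b0; apply: measurable_funM; first exact: measurable_powR.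
have mml : measurable_fun [set: R] (ml2 a b).
  exact: continuous_measurable_fun (continuous_ml2 a0 b0).
by apply: (measurableT_comp mml); exact: measurable_funM.
Qed.

Let argument_le a m t x : 0 < a -> 0 <= x -> x <= t ->
  `|m * x `^ a| <= `|m| * t `^ a.
Proof.
move=> a0 x0 xt; rewrite normrM ler_wpM2l// ger0_norm ?powR_ge0//.
by apply: ge0_ler_powR; rewrite ?nnegrE ?(ltW a0)// (le_trans x0 xt).
Qed.

Lemma loc_integrable_ml_kernel a b m : 0 < a -> 0 < b ->
  loc_integrable (ml_kernel a b m).
Proof.
move=> a0 b0 T T0.
have [C hC] := entire_bound (`|m| * T `^ a) (ml_coef_entire a0 b0).
apply: (@integrableM_bounded _ _ (fun x => x `^ (b - 1))
  (fun x => ml2 a b (m * x `^ a)) (2 * C)) => //.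
- by apply: loc_integrable_powR.
- apply: measurable_funTS.
  have mml : measurable_fun [set: R] (ml2 a b).
    exact: continuous_measurable_fun (continuous_ml2 a0 b0).
  by apply: (measurableT_comp mml); exact: measurable_funM.
- move=> x /=; rewrite in_itv/= => /andP[x0 xT].
  by have [_ _] := half_series_bound (hC _ (argument_le m a0 x0 xT)).
Qed.

(** At t >= 1 take M = w t with w^a = 2 |m| + 1 in the bound for E_{a,b}; the
result is a multiple of e^(w t). *)
Lemma laplace_ml_kernel a b m : 0 < a -> 0 < b ->
  laplace_transformable (ml_kernel a b m).
Proof.
move=> a0 b0; pose w := (2 * `|m| + 1) `^ (a^-1).
have m0 : 0 < 2 * `|m| + 1 by rewrite ltr_wpDl// mulr_ge0.
have w0 : 0 < w by rewrite powR_gt0.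
apply: (@laplace_transformable_bound _ _
  (2 * (w `^ b)^-1 * (w + 1) * expR 1) w); first exact: loc_integrable_ml_kernel.
move=> t t1; have t0 : 0 < t by exact: lt_le_trans t1.
have wt0 : 0 < w * t by rewrite mulr_gt0.
have h : `|m * t `^ a| <= (w * t) `^ a / 2.
  rewrite normrM (ger0_norm (powR_ge0 _ _)) powRM ?(ltW w0) ?(ltW t0)//.
  rewrite /w -powRrM mulVf ?gt_eqF// powRr1 ?(ltW m0)//.
  rewrite mulrAC ler_wpM2r ?powR_ge0//.
  by rewrite ler_pdivlMr// mulrC lerDl.
rewrite /ml_kernel normrM (ger0_norm (powR_ge0 _ _)).
apply: (le_trans (ler_wpM2l (powR_ge0 _ _) (ml2_le a0 b0 wt0 h))).
rewrite powRM ?(ltW w0) ?(ltW t0)//.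
have -> : t `^ (b - 1) = t `^ b / t.
  by rewrite powRB ?(powRr1 (ltW t0))// (gt_eqF t0) implybT.
rewrite expRD.
have tb := powR_gt0 b t0; have wb := powR_gt0 b w0.
rewrite [leLHS](_ : _ = 2 * (w `^ b)^-1 * ((w * t + 1) / t) *
    expR 1 * expR (w * t)); last first.
  by field; rewrite !gt_eqF.
rewrite ler_wpM2r ?expR_ge0// ler_wpM2r ?expR_ge0// ler_wpM2l//.
  by rewrite mulr_ge0// invr_ge0 ltW.
rewrite mulrDl mulfK ?gt_eqF// lerD2l mul1r invf_le1//.
Qed.

Let integral_itv0 (f : R -> \bar R) t : measurable_fun [set: R] f ->
  (\int[mu]_(x in `]0%R, t]) f x = \int[mu]_(x in `[0%R, t]) f x)%E.
Proof. by move=> mf; rewrite integral_itv_obnd_cbnd//; exact: measurable_funTS. Qed.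

Let mtx t : measurable_fun [set: R] (fun x => t - x).
Proof. exact: measurable_funB. Qed.

Let measurable_pk b : measurable_fun [set: R] (power_kernel b).
Proof. by apply: measurable_funM. Qed.

Let measurable_pk2 b g t :
  measurable_fun [set: R] (fun x => (power_kernel g (t - x) * power_kernel b x)%:E).
Proof.
apply/measurable_EFinP; apply: measurable_funM => //.
exact: (measurableT_comp (measurable_pk g) (mtx t)).
Qed.

Let power_kernel_ge0 b x : 0 < b -> 0 <= power_kernel b x.
Proof. by move=> b0; rewrite divr_ge0 ?powR_ge0// ltW// Gamma_fun_gt0. Qed.

Let integral_power_kernel b g t : 0 < b -> 0 < g -> 0 < t ->
  (\int[mu]_(x in `]0%R, t]) (power_kernel g (t - x) * power_kernel b x)%:E =
   (power_kernel (g + b) t)%:E)%E.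
Proof.
move=> b0 g0 t0; rewrite integral_itv0//.
have gb0 : 0 < g + b by rewrite addr_gt0.
have IB := integral_beta g0 b0 t0; rewrite /power_kernel.
move: (Gamma_fun g) (Gamma_fun b) (Gamma_fun (g + b)) IB
  (Gamma_fun_gt0 g0) (Gamma_fun_gt0 b0) (Gamma_fun_gt0 gb0).
move=> G1 G2 G3 IB G1_gt0 G2_gt0 G3_gt0.
transitivity (\int[mu]_(x in `[0%R, t])
    ((G1 * G2)^-1%:E * ((t - x) `^ (g - 1) * x `^ (b - 1))%:E))%E.
  apply: eq_integral => x _; rewrite -EFinM; congr EFin.
  by rewrite invfM mulrACA mulrC.
rewrite ge0_integralZl//; last 3 first.
- apply/measurable_EFinP; apply: measurable_funM => //.
    by apply: measurable_funTS; exact: (measurableT_comp (measurable_powR _) (mtx t)).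
  by apply: measurable_funTS; exact: measurable_powR.
- by move=> x _; rewrite lee_fin mulr_ge0 ?powR_ge0.
- by rewrite lee_fin invr_ge0 mulr_ge0// ltW.
rewrite IB -EFinM; congr EFin.
by field; rewrite !gt_eqF.
Qed.

Let integrable_power_kernel b g t : 0 < b -> 0 < g -> 0 < t ->
  mu.-integrable `]0, t]
    (fun x => (power_kernel g (t - x) * power_kernel b x)%:E).
Proof.
move=> b0 g0 t0; apply/integrableP; split.
  exact: (measurable_funTS (measurable_pk2 b g t)).
under eq_integral => x _ do
  rewrite abse_EFin (ger0_norm (mulr_ge0 (power_kernel_ge0 _ g0)
    (power_kernel_ge0 _ b0))).
by rewrite integral_power_kernel// ltry.
Qed.

(** Termwise p_g * p_{a n + b} = p_{g + a n + b} by the beta integral. The partial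
sums of the series are bounded by a multiple of x^(b-1), integrable against
p_g(t - x), and dominated convergence applies. *)
Lemma conv_power_ml_kernel a b g m t : 0 < a -> 0 < b -> 0 < g -> 0 < t ->
  conv (power_kernel g) (ml_kernel a b m) t = ml_kernel a (g + b) m t.
Proof.
move=> a0 b0 g0 t0; have gb0 : 0 < g + b by rewrite addr_gt0.
pose u i x := power_kernel g (t - x) *
  (x `^ (b - 1) * (ml_coef a b i * (m * x `^ a) ^+ i)).
have uE i x : 0 < x -> (u i x)%:E = ((m ^+ i)%:E *
    (power_kernel g (t - x) * power_kernel (a * i%:R + b) x)%:E)%E.
  move=> x0; rewrite -EFinM; congr EFin; rewrite /u /power_kernel /ml_coef.
  have -> : a * i%:R + b - 1 = (b - 1) + a * i%:R by lra.
  rewrite (@powRD _ _ (b - 1)) ?(gt_eqF x0) ?implybT//.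
  rewrite (@powRrM _ x a) powR_mulrn ?powR_ge0// exprMn.
  by ring.
have iu i : mu.-integrable `]0, t] (fun x => (u i x)%:E) /\
    (\int[mu]_(x in `]0%R, t]) (u i x)%:E =
     (m ^+ i * power_kernel (g + (a * i%:R + b)) t)%:E)%E.
  have z0 := arg_gt0 i a0 b0.
  have iP := integrable_power_kernel z0 g0 t0.
  split.
    apply: (@eq_integrable _ _ _ mu _ _ (fun x => (m ^+ i)%:E *
      (power_kernel g (t - x) * power_kernel (a * i%:R + b) x)%:E)%E) => //.
      by move=> x; rewrite inE/= in_itv/= => /andP[x0 _]; rewrite uE.
    exact: integrableZl.
  transitivity (\int[mu]_(x in `]0%R, t]) ((m ^+ i)%:E *
      (power_kernel g (t - x) * power_kernel (a * i%:R + b) x)%:E))%E.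
    by apply: eq_integral => x; rewrite inE/= in_itv/= => /andP[x0 _]; rewrite uE.
  by rewrite integralZl// integral_power_kernel.
pose f_ n x := (power_kernel g (t - x) *
  (x `^ (b - 1) * pseries (ml_coef a b) (m * x `^ a) n))%:E.
have fS n x : f_ n.+1 x = (f_ n x + (u n x)%:E)%E.
  by rewrite /f_ /u -EFinD; congr EFin; rewrite /pseries seriesSr !mulrDr.
have f0 x : f_ 0 x = 0%E.
  by rewrite /f_ /pseries /series/= big_geq// !mulr0.
have if_ n : mu.-integrable `]0, t] (f_ n) /\ (\int[mu]_(x in `]0%R, t]) f_ n x =
    (t `^ (g + b - 1) * pseries (ml_coef a (g + b)) (m * t `^ a) n)%:E)%E.
  elim: n => [|n [IHi IHe]].
    have -> : f_ 0 = cst 0%E by apply/funext.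
    split; first exact: integrable0.
    by rewrite integral0 /pseries /series/= big_geq// mulr0.
  have [iun eun] := iu n.
  have -> : f_ n.+1 = (f_ n \+ (fun x => (u n x)%:E))%E by apply/funext.
  split; first exact: integrableD.
  rewrite integralD// IHe eun -EFinD; congr EFin.
  rewrite /pseries seriesSr mulrDr; congr (_ + _).
  rewrite /power_kernel /ml_coef /=.
  have -> : g + (a * n%:R + b) = a * n%:R + (g + b) by lra.
  have -> : a * n%:R + (g + b) - 1 = (g + b - 1) + a * n%:R by lra.
  rewrite (@powRD _ _ (g + b - 1)) ?(gt_eqF t0) ?implybT//.
  rewrite (@powRrM _ t a) powR_mulrn ?powR_ge0// exprMn.
  by ring.
have [C hC] := entire_bound (`|m| * t `^ a) (ml_coef_entire a0 b0).
have mK := measurable_ml_kernel m a0 b0.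
have mf : measurable_fun [set: R]
    (fun x => (power_kernel g (t - x) * ml_kernel a b m x)%:E).
  apply/measurable_EFinP; apply: measurable_funM => //.
  exact: (measurableT_comp (measurable_pk g) (mtx t)).
have dom : mu.-integrable `]0, t] (fun x => (2 * C * Gamma_fun b)%:E *
    (power_kernel g (t - x) * power_kernel b x)%:E)%E.
  by apply: integrableZl => //; exact: integrable_power_kernel.
have ff : {ae mu, forall x, (`]0, t]%classic : set R) x -> f_ ^~ x @ \oo -->
    (power_kernel g (t - x) * ml_kernel a b m x)%:E}.
  apply: aeW => x _; apply: cvg_EFin; first exact: nearW.
  apply: cvgM; first exact: cvg_cst.
  apply: cvgM; first exact: cvg_cst.
  exact: entire_cvg (ml_coef_entire a0 b0).
have fg : {ae mu, forall x n, (`]0%R, t]%classic : set R) x -> (`|f_ n x| <= (2 * C * Gamma_fun b)%:E *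
    (power_kernel g (t - x) * power_kernel b x)%:E)%E}.
  apply: aeW => x n; rewrite /= in_itv/= => /andP[x0 xt].
  have [_ h _] := half_series_bound (hC _ (argument_le m a0 (ltW x0) xt)).
  have cancel (G p y : R) : G != 0 ->
      2 * C * G * (p * (y / G)) = p * (y * (2 * C)) by move=> G0; field.
  rewrite -EFinM lee_fin.
  have -> : 2 * C * Gamma_fun b * (power_kernel g (t - x) * power_kernel b x) =
      power_kernel g (t - x) * (x `^ (b - 1) * (2 * C)).
    by apply: cancel; rewrite gt_eqF// Gamma_fun_gt0.
  rewrite normrM (ger0_norm (power_kernel_ge0 _ _))//.
  rewrite ler_wpM2l ?power_kernel_ge0//.
  by rewrite normrM (ger0_norm (powR_ge0 _ _)) ler_wpM2l ?powR_ge0//; exact: h.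
have mf_ n : measurable_fun `]0, t] (f_ n) by exact: measurable_int (if_ n).1.
have mfD : measurable_fun `]0, t]
    (fun x => (power_kernel g (t - x) * ml_kernel a b m x)%:E).
  exact: measurable_funTS.
have [_ _ cvI] := @dominated_convergence _ _ _ mu (`]0%R, t]%classic : set R)
  (measurable_itv _) f_ _ _ mf_ mfD ff dom fg.
rewrite /conv /Rintegral -integral_itv0//.
have -> : (\int[mu]_(x in `]0%R, t])
    (power_kernel g (t - x) * ml_kernel a b m x)%:E =
    (ml_kernel a (g + b) m t)%:E)%E; last by [].
apply: (cvg_unique _ cvI) => //.
have -> : [sequence (\int[mu]_(x in `]0%R, t]) f_ n x)%E]_n = (fun n =>
    (t `^ (g + b - 1) * pseries (ml_coef a (g + b)) (m * t `^ a) n)%:E).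
  by apply/funext => n; exact: (if_ n).2.
apply: cvg_EFin; first exact: nearW.
apply: cvgM; first exact: cvg_cst.
exact: entire_cvg (ml_coef_entire a0 gb0).
Qed.

End mittag_leffler_kernel.

(** * Inverse of the Volterra operator *)

Section resolvent_pair.
Context {R : realType}.
Notation mu := (@lebesgue_measure R).
Variables (r q : R -> R) (b k : R).
Hypotheses (lr : loc_integrable r) (lq : loc_integrable q)
  (b0 : b != 0) (k0 : k != 0) (k1 : 1 - k != 0).
(** The resolvent relation (1 - k) r + k q + r * q = 0, through its action on
locally bounded functions. *)
Hypothesis rq : forall c, loc_bounded c ->
  conv r (conv q c) = (k - 1) *: conv r c + (- k) *: conv q c.

Let one : R -> R := cst 1.
Let b1 : loc_bounded one := loc_bounded_cst 1.
Let l1 : loc_integrable one := loc_integrable_bounded b1.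

Definition volterra_op (u : R -> R) : R -> R :=
  (b * (1 - k)) *: u + b *: conv q u.

Definition volterra_inv (u : R -> R) : R -> R :=
  (b * (1 - k))^-1 *: u + (b * k * (1 - k))^-1 *: conv r u.

Lemma volterra_op_bounded u : loc_bounded u -> loc_bounded (volterra_op u).
Proof.
move=> bu; apply: loc_boundedD; apply: loc_boundedZ => //.
exact: loc_bounded_conv.
Qed.

Lemma volterra_opK u : loc_bounded u -> volterra_inv (volterra_op u) = u.
Proof.
move=> bu; have bqu := loc_bounded_conv lq bu.
rewrite /volterra_inv {2}/volterra_op convDr//; [|exact: loc_boundedZ..].
rewrite !convZr// rq//; apply/funext => t.
rewrite /volterra_op; change ((b * (1 - k))^-1 *
  (b * (1 - k) * u t + b * conv q u t) + (b * k * (1 - k))^-1 *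
  (b * (1 - k) * conv r u t +
   b * ((k - 1) * conv r u t + (- k) * conv q u t)) = u t).
by field; rewrite k1 k0 b0.
Qed.

Lemma volterra_invK u : loc_bounded u -> volterra_op (volterra_inv u) = u.
Proof.
move=> bu; have bru := loc_bounded_conv lr bu.
have qr : conv q (conv r u) = (k - 1) *: conv r u + (- k) *: conv q u.
  by rewrite convA// (convC lq lr) -convA// rq.
rewrite /volterra_op {2}/volterra_inv convDr//; [|exact: loc_boundedZ..].
rewrite !convZr// qr; apply/funext => t.
rewrite /volterra_inv; change (b * (1 - k) * ((b * (1 - k))^-1 * u t +
  (b * k * (1 - k))^-1 * conv r u t) + b * ((b * (1 - k))^-1 * conv q u t +
  (b * k * (1 - k))^-1 * ((k - 1) * conv r u t + (- k) * conv q u t)) = u t).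
by field; rewrite k1 k0 b0.
Qed.

(** Convolution with 1 turns g into the locally bounded g * 1, to which
[volterra_invK] applies: it gives g * 1 = volterra_op u * 1, and two functions
with the same primitive agree almost everywhere. *)
Lemma volterra_inv_ae u g : loc_bounded u -> loc_integrable g ->
  {ae mu, forall t : R, 0 <= t -> u t = volterra_inv g t} ->
  {ae mu, forall t : R, 0 <= t -> g t = volterra_op u t}.
Proof.
move=> bu lg ug; have lu := loc_integrable_bounded bu.
have bg1 := loc_bounded_conv lg b1.
have lrg := loc_integrable_conv lr lg.
have linv : loc_integrable (volterra_inv g) by apply: loc_integrableD; exact: loc_integrableZ.
have lop := loc_integrable_bounded (volterra_op_bounded bu).
have lqu := loc_integrable_conv lq lu.
have E : conv u one = volterra_inv (conv g one).
  rewrite convC// (conv_ae_eq l1 lu linv ug) convC// /volterra_inv.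
  by rewrite convDl ?convZl -?convA//; exact: loc_integrableZ.
have E' : conv (volterra_op u) one = volterra_op (conv u one).
  by rewrite /volterra_op convDl ?convZl -?convA//; exact: loc_integrableZ.
apply: loc_integrable_ae_eq => // t _.
by rewrite (convC l1 lop) (convC l1 lg) E' E volterra_invK.
Qed.

Lemma locally_AC_volterra_op u : locally_AC u -> locally_AC (volterra_op u).
Proof.
move=> cu; apply: locally_AC_D; apply: locally_AC_Z => //.
exact: locally_AC_conv.
Qed.

(** The operator maps the relaxation function 1 + r * 1 to a multiple of the
relaxation function 1 + q * 1: this is how the initial value enters the
solution formula. *)
Lemma volterra_op_relaxation :
  volterra_op (one + conv r one) = (b * (1 - k)) *: (one + conv q one).
Proof.
have br1 := loc_bounded_conv lr b1.
have qr : conv q (conv r one) = (k - 1) *: conv r one + (- k) *: conv q one.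
  by rewrite convA// (convC lq lr) -convA// rq.
rewrite /volterra_op convDr// qr; apply/funext => t.
change (b * (1 - k) * (1 + conv r one t) + b * (conv q one t +
  ((k - 1) * conv r one t + (- k) * conv q one t)) =
  b * (1 - k) * (1 + conv q one t)).
by ring.
Qed.

(** The convolution of the relaxation function with g is a primitive of g + r * g. *)
Lemma conv_relaxation g : loc_integrable g ->
  conv (one + conv r one) g = conv one (g + conv r g).
Proof.
move=> lg; have br1 := loc_bounded_conv lr b1.
have lr1 := loc_integrable_bounded br1; have lrg := loc_integrable_conv lr lg.
rewrite (convC (loc_integrableD l1 lr1) lg) convDr// convA// (convC lg lr).
by rewrite -convDl// convC//; exact: loc_integrableD.
Qed.

End resolvent_pair.

(** * Resolvent identity for the Mittag-Leffler kernels *)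

Section mittag_leffler_resolvent.
Context {R : realType}.
Notation mu := (@lebesgue_measure R).
Local Opaque Gamma_fun conv.

Lemma Gamma_fun1 : Gamma_fun 1 = 1 :> R.
Proof.
Local Transparent Gamma_fun.
rewrite /Gamma_fun /Rintegral.
transitivity (fine (\int[mu]_(x in `]0%R, +oo[) (expR (- (1 * x)))%:E)%E).
  congr fine; apply: eq_integral => x _.
  by rewrite subrr powRr0 mul1r mul1r.
rewrite integral_itv_obnd_cbnd ?integral_expR ?invr1//.
apply: measurable_funTS; apply/measurable_EFinP; apply: measurableT_comp => //.
by apply: measurable_funN; exact: measurable_funM.
Qed.
Local Opaque Gamma_fun.

Variable a : R.
Hypotheses (a0 : 0 < a) (a1 : a < 1).

Let one : R -> R := cst 1.
Let b1 : loc_bounded one := loc_bounded_cst 1.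
Let l1 : loc_integrable one := loc_integrable_bounded b1.

Let K (m : R) : R -> R := ml_kernel a a m.
Let P : R -> R := power_kernel a.
Let lK m : loc_integrable (K m) := loc_integrable_ml_kernel m a0 a0.

Let power_kernel1 : power_kernel 1 = one.
Proof.
by apply/funext => t; rewrite /power_kernel subrr powRr0 Gamma_fun1 divr1.
Qed.

(** By [conv_power_ml_kernel] with g = 1, integrating the kernel of E_{a,a} gives,
up to the factor m, the Mittag-Leffler series without its first term. *)
Lemma mittag_leffler_relaxation m t : 0 <= t ->
  mittag_leffler a (m * t `^ a) = (one + m *: conv (K m) one) t.
Proof.
rewrite mittag_lefflerE -[RHS]/(1 + m * conv (K m) one t) convC//.
rewrite le_eqVlt => /predU1P[<-|t0].
  rewrite conv_at0 powR0 ?gt_eqF// !mulr0 addr0 ml2_rec//.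
  by rewrite Gamma_fun1 invr1 mul0r addr0.
rewrite -power_kernel1 conv_power_ml_kernel//.
have := ml_kernel_rec m a0 (@ltr01 R) t0.
rewrite power_kernel1 -[one t]/1 (addrC 1 a) => <-.
by rewrite /ml_kernel subrr powRr0 mul1r.
Qed.

Let lP : loc_integrable P.
Proof.
move=> T T0; have := integrableZl _ (Gamma_fun a)^-1 (loc_integrable_powR a0 T0).
move=> /(_ (measurable_itv _)); apply: eq_integrable => // x _.
by rewrite -EFinM mulrC.
Qed.

Let K_rec m t : 0 <= t -> K m t = (P + m *: conv P (K m)) t.
Proof.
rewrite -[RHS]/(P t + m * conv P (K m) t).
rewrite le_eqVlt => /predU1P[<-|t0].
  rewrite conv_at0 mulr0 addr0 /K /P /ml_kernel /power_kernel.
  by rewrite powR0 ?mul0r// subr_eq0 lt_eqF.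
by rewrite conv_power_ml_kernel// -ml_kernel_rec.
Qed.

Let convK m c : loc_bounded c ->
  conv (K m) c = conv P c + m *: conv P (conv (K m) c).
Proof.
move=> bc; have lPK := loc_integrable_conv lP (lK m).
rewrite {1}(conv_congr (K_rec m) (fun x _ => erefl (c x))).
by rewrite convDl ?convZl ?convA//; exact: loc_integrableZ.
Qed.

(** Let X = K_m * K_n * 1. Expanding K_m gives X = P * K_n * 1 + m (P * X),
expanding K_n gives X = P * K_m * 1 + n (P * X). In the difference of n times
the first and m times the second, P * X cancels and the rest is read off from
the expansions of K_m * 1 and K_n * 1. *)
Let K_resolvent_primitive m n :
  (m - n) *: conv (K m) (conv (K n) one) = conv (K m) one - conv (K n) one.
Proof.
have bH i : loc_bounded (conv (K i) one) by exact: loc_bounded_conv.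
have bP c : loc_bounded c -> loc_bounded (conv P c) by exact: loc_bounded_conv.
set X := conv (K m) (conv (K n) one).
have bX : loc_bounded X by exact: loc_bounded_conv.
have KP c : loc_bounded c -> conv (K m) (conv P c) = conv P (conv (K m) c).
  by move=> bc; rewrite convA// (convC (lK m) lP) -convA.
have X1 : X = conv P (conv (K n) one) + m *: conv P X.
  by rewrite {1}/X convK.
have X2 : X = conv P (conv (K m) one) + n *: conv P X.
  have bPH := bP _ (bH n); have bP1 := bP _ b1; have bZ := loc_boundedZ n bPH.
  rewrite {1}/X (convK n b1) (convDr (lK m) bP1 bZ) (convZr n (lK m) bPH).
  by rewrite (KP _ b1) (KP _ (bH n)) -/X.
have Hm := convK m b1; have Hn := convK n b1.
apply/funext => t.
have := congr1 (@^~ t) X1; have := congr1 (@^~ t) X2.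
have := congr1 (@^~ t) Hm; have := congr1 (@^~ t) Hn.
change (conv (K n) one t = conv P one t + n * conv P (conv (K n) one) t ->
  conv (K m) one t = conv P one t + m * conv P (conv (K m) one) t ->
  X t = conv P (conv (K m) one) t + n * conv P X t ->
  X t = conv P (conv (K n) one) t + m * conv P X t ->
  (m - n) * X t = conv (K m) one t - conv (K n) one t).
move: (conv (K n) one t) (conv (K m) one t) (conv P one t)
  (conv P (conv (K n) one) t) (conv P (conv (K m) one) t) (conv P X t) (X t).
move=> hn hm p pn pm px x -> -> E1 E2; rewrite mulrBl {1}E1 E2.
by ring.
Qed.

(** By differentiating the primitives, (m - n) K_m * K_n and K_m - K_n agree almost
everywhere, hence so do their convolutions with c. *)
Lemma ml_kernel_resolvent m n c : loc_bounded c ->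
  (m - n) *: conv (K m) (conv (K n) c) = conv (K m) c - conv (K n) c.
Proof.
move=> bc; have lKK := loc_integrable_conv (lK m) (lK n).
have lD : loc_integrable (K m + (-1) *: K n) by apply: loc_integrableD => //; exact: loc_integrableZ.
have E : {ae mu, forall t : R, 0 <= t ->
    ((m - n) *: conv (K m) (K n)) t = (K m + (-1) *: K n) t}.
  apply: loc_integrable_ae_eq => // [|t _]; first exact: loc_integrableZ.
  rewrite (convC l1 (loc_integrableZ _ lKK)) (convC l1 lD).
  rewrite convZl// -convA// K_resolvent_primitive.
  rewrite convDl ?convZl//; last exact: loc_integrableZ.
  by rewrite scaleN1r.
have lc := loc_integrable_bounded bc.
rewrite convA// -convZl// (convC (loc_integrableZ _ lKK) lc)
  (conv_ae_eq lc (loc_integrableZ _ lKK) lD E).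
rewrite (convC lc lD) convDl ?convZl//; last exact: loc_integrableZ.
by rewrite scaleN1r.
Qed.

Lemma mittag_leffler_derive m t : 0 < t ->
  derivable (fun s : R => mittag_leffler a (m * s `^ a)) t 1 /\
  derive1 (fun s : R => mittag_leffler a (m * s `^ a)) t = m * K m t.
Proof.
move=> t0; have t1 : t < t + 1 by rewrite ltrDl.
have it : mu.-integrable `[0, t + 1] (EFin \o K m).
  by apply: lK; rewrite addr_ge0// ltW.
have [] := continuous_FTC1_closed t1 it t0 (@continuous_ml_kernel _ _ _ m _ a0 a0 t0).
set I := (fun x : R => \int[mu]_(s in `[0, x]) K m s) => dI I'.
have E : \forall s \near t, 1 + m * I s = mittag_leffler a (m * s `^ a).
  near=> s; have s0 : 0 < s by near: s; exact: lt_nbhsr.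
  rewrite mittag_leffler_relaxation ?ltW// -[RHS]/(1 + m * conv (K m) one s).
  by rewrite convC// conv1E.
have dI' : is_derive t 1 I (K m t).
  by apply: DeriveDef; [exact: dI|rewrite -derive1E].
have dJ : is_derive t 1 (fun s => 1 + m * I s) (0 + m * K m t).
  exact: (is_deriveD (is_derive_cst _ _ _) (is_deriveZ m dI')).
have [d1 d2] := near_eq_is_derive E dJ.
split; first exact: d1.
by rewrite derive1E d2 add0r.
Unshelve. all: by end_near. Qed.

End mittag_leffler_resolvent.

(** * The fractional relaxation equation *)

Section relaxation_equation.
Context {R : realType}.
Notation mu := (@lebesgue_measure R).
Local Opaque conv Gamma_fun.

Variables (r q E e g : R -> R) (b k : R).
Hypotheses (lr : loc_integrable r) (lq : loc_integrable q)
  (b_neq0 : b != 0) (k_neq0 : k != 0).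
Hypothesis k1 : 1 - k != 0.
Hypothesis rq : forall c, loc_bounded c ->
  conv r (conv q c) = (k - 1) *: conv r c + (- k) *: conv q c.
Hypothesis EE : forall t, 0 <= t -> E t = (cst 1 + conv r (cst 1)) t.
Hypothesis eE : forall t, 0 <= t -> e t = (cst 1 + conv q (cst 1)) t.
Hypothesis lg : loc_integrable g.

Let one : R -> R := cst 1.
Let b1 : loc_bounded one := loc_bounded_cst 1.
Let l1 : loc_integrable one := loc_integrable_bounded b1.
Let op := volterra_op q b k.

(** The term of the solution formulas that depends on f(0). *)
Definition homogeneous_part (f : R -> R) : R -> R :=
  ((1 - k)^-1 * f 0) *: (one + conv r one).

Definition forced_part (f : R -> R) : R -> R :=
  f + (-1) *: homogeneous_part f.

Lemma forced_partE f t : 0 <= t ->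
  f t = forced_part f t + (1 - k)^-1 * E t * f 0.
Proof.
move=> t0; rewrite EE//.
change (f t = f t + (-1) * ((1 - k)^-1 * f 0 * (one + conv r one) t) +
  (1 - k)^-1 * (one + conv r one) t * f 0).
by ring.
Qed.

Lemma locally_AC_homogeneous_part f : locally_AC (homogeneous_part f).
Proof.
apply: locally_AC_Z; apply: locally_AC_D; first exact: locally_AC_cst.
by apply: locally_AC_conv => //; exact: locally_AC_cst.
Qed.

Lemma locally_AC_forced_part f : locally_AC f -> locally_AC (forced_part f).
Proof.
move=> cf; apply: locally_AC_D => //; apply: locally_AC_Z.
exact: locally_AC_homogeneous_part.
Qed.

(** Almost everywhere f is differentiable with derivative its density h. With
e = 1 + q * 1, associativity gives e * h = h * 1 + q * (h * 1), where h * 1 =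
f - f(0); the contribution of f(0) is absorbed by [volterra_op_relaxation]. *)
Lemma relaxation_operatorE f t : locally_AC f -> 0 <= t ->
  b * \int[mu]_(x in `[0, t]) (derive1 f x * e (t - x)) - b * k * f t =
  op (forced_part f) t.
Proof.
move=> cf t0; have [h [lh fE f'E]] := locally_AC_derive cf.
have bq1 := loc_bounded_conv lq b1; have be := loc_boundedD b1 bq1.
have le1 : loc_integrable e.
  by apply: (@loc_integrable_congr _ (one + conv q one)) => [x /eE//|]; exact: loc_integrable_bounded.
have -> : \int[mu]_(x in `[0, t]) (derive1 f x * e (t - x)) = conv e h t.
  rewrite convE /Rintegral; congr fine; apply: ae_eq_integral_left => //.
    apply/measurable_EFinP; apply: measurable_funM.
      by apply/measurable_EFinP; exact: measurable_int (integrable_reflect t le1).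
    by apply/measurable_EFinP; exact: measurable_int (lh t t0).
  apply: filterS f'E => x f'E; rewrite /= in_itv/= => /andP[x0 _].
  by rewrite mulrC f'E.
have bf := locally_AC_bounded cf.
have fE' s : 0 <= s -> conv h one s = (f + (- f 0) *: one) s.
  move=> s0; rewrite convC// -[RHS]/(f s + - f 0 * 1) fE// mulr1.
  by rewrite addrAC subrr add0r.
have -> : conv e h = conv h one + (conv q f + (- f 0) *: conv q one).
  rewrite (conv_congr eE (fun x _ => erefl (h x))).
  rewrite (convC (loc_integrable_bounded be) lh) convDr// convA// (convC lh lq) -convA//.
  rewrite (conv_congr (fun x _ => erefl (q x)) fE') convDr ?convZr//.
  exact: loc_boundedZ.
have -> : op (forced_part f) t =
    b * (1 - k) * f t + b * conv q f t - b * f 0 * (1 + conv q one t).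
  have bH := locally_AC_bounded (locally_AC_homogeneous_part f).
  rewrite /op /volterra_op /forced_part convDr//; last exact: loc_boundedZ.
  rewrite convZr//.
  have br1 := loc_bounded_conv lr b1.
  have rel := volterra_op_relaxation b lr lq rq.
  rewrite /homogeneous_part convZr//; last exact: loc_boundedD.
  have := congr1 (@^~ t) rel; rewrite /volterra_op.
  change (b * (1 - k) * (one + conv r one) t + b * conv q (one + conv r one) t =
    b * (1 - k) * (1 + conv q one t) ->
    b * (1 - k) * (f t + (-1) * ((1 - k)^-1 * f 0 * (one + conv r one) t)) +
    b * (conv q f t + (-1) * ((1 - k)^-1 * f 0 * conv q (one + conv r one) t)) =
    b * (1 - k) * f t + b * conv q f t - b * f 0 * (1 + conv q one t)).
  move: ((one + conv r one) t) (conv q (one + conv r one) t) (conv q one t)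
    (conv q f t) (f t) (f 0) => x y z w v f0 H.
  have -> : b * (1 - k) * (v + -1 * ((1 - k)^-1 * f0 * x)) +
      b * (w + -1 * ((1 - k)^-1 * f0 * y)) =
      b * (1 - k) * v + b * w - (1 - k)^-1 * f0 * (b * (1 - k) * x + b * y).
    by ring.
  by rewrite H; field.
change (b * (conv h one t + (conv q f t + (- f 0) * conv q one t)) - b * k * f t =
  b * (1 - k) * f t + b * conv q f t - b * f 0 * (1 + conv q one t)).
rewrite fE'//; change (b * (f t + - f 0 * 1 + (conv q f t + - f 0 * conv q one t)) -
  b * k * f t =
  b * (1 - k) * f t + b * conv q f t - b * f 0 * (1 + conv q one t)).
move: (conv q f t) (conv q one t) (f t) (f 0) => x y z w.
by ring.
Qed.

Hypothesis dE : forall t, 0 < t -> derivable E t 1 /\ derive1 E t = r t.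

Let conv_EE : conv E g = conv one (g + conv r g).
Proof.
rewrite (conv_congr EE (fun x _ => erefl (g x))).
by rewrite conv_relaxation.
Qed.

Let lE : loc_integrable E.
Proof.
apply: (@loc_integrable_congr _ (one + conv r one)) => [x /EE//|].
by apply: loc_integrableD => //; exact: loc_integrable_conv.
Qed.

(** The convolution does not change if g is replaced by the absolutely continuous
op u, and then it is a primitive of a continuous function. *)
Lemma convolution_derive u : locally_AC u ->
  {ae mu, forall t : R, 0 <= t -> g t = op u t} ->
  forall t, 0 < t -> derivable (conv E g) t 1 /\
    derive1 (conv E g) t = op u t + conv r (op u) t.
Proof.
move=> cu gu t t0.
have cop : locally_AC (op u) by exact: locally_AC_volterra_op.
have lop := loc_integrable_bounded (locally_AC_bounded cop).
have cv : locally_AC (op u + conv r (op u)).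
  by apply: locally_AC_D => //; exact: locally_AC_conv.
have lv := loc_integrable_bounded (locally_AC_bounded cv).
have -> : conv E g = fun s => \int[mu]_(x in `[0, s]) (op u + conv r (op u)) x.
  rewrite (conv_ae_eq lE lg lop gu) (conv_congr EE (fun x _ => erefl (op u x))).
  by rewrite conv_relaxation//; apply/funext => s; rewrite conv1E.
have t1 : t < t + 1 by rewrite ltrDl.
have iv : mu.-integrable `[0, t + 1] (EFin \o (op u + conv r (op u))).
  by apply: lv; rewrite addr_ge0// ltW.
exact: (continuous_FTC1_closed t1 iv t0 (locally_AC_continuous cv t0)).
Qed.

Lemma convolution_derive_ae :
  {ae mu, forall t : R, 0 <= t -> derive1 (conv E g) t = g t + conv r g t}.
Proof.
have lv : loc_integrable (g + conv r g) by apply: loc_integrableD => //; exact: loc_integrable_conv.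
have -> : conv E g = fun s => \int[mu]_(x in `[0, s]) (g + conv r g) x.
  by rewrite conv_EE; apply/funext => s; rewrite conv1E.
by apply: ae_gt0W; apply: filterS (primitive_derive_ae lv) => t H /H[].
Qed.

Let opK f t : locally_AC f -> 0 <= t -> f t =
  (b * (1 - k))^-1 * op (forced_part f) t +
  (b * k * (1 - k))^-1 * conv r (op (forced_part f)) t +
  (1 - k)^-1 * E t * f 0.
Proof.
move=> cf t0; have bu := locally_AC_bounded (locally_AC_forced_part cf).
rewrite (forced_partE f t0); congr (_ + _).
by have /(congr1 (@^~ t))/= <- := volterra_opK lr lq b_neq0 k_neq0 k1 rq bu.
Qed.

Let op_ae f : (forall t, 0 < t -> op (forced_part f) t = g t) ->
  {ae mu, forall t : R, 0 <= t -> g t = op (forced_part f) t}.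
Proof.
by move=> fg; apply: ae_gt0W; apply: aeW => t t0; rewrite fg.
Qed.

Let inv_ae f : locally_AC f ->
  {ae mu, forall t : R, 0 <= t -> f t = (b * (1 - k))^-1 * g t +
     (b * k * (1 - k))^-1 * conv r g t + (1 - k)^-1 * E t * f 0} ->
  {ae mu, forall t : R, 0 <= t -> g t = op (forced_part f) t}.
Proof.
move=> cf fg; have bu := locally_AC_bounded (locally_AC_forced_part cf).
apply: (volterra_inv_ae lr lq b_neq0 k_neq0 k1 rq bu lg).
apply: filterS fg => t ft t0; have := ft t0; rewrite {1}(forced_partE f t0).
by move=> /addIr.
Qed.

(** From the formula, [convolution_derive_ae] and [inv_ae] give g = op (forced_part
f) almost everywhere; then [convolution_derive] evaluates the derivative at
every t, and comparing with [opK] isolates g t. *)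
Lemma derivative_formula f : locally_AC f ->
  (forall t, 0 < t -> op (forced_part f) t = g t) <->
  (forall t, 0 < t -> derivable (conv E g) t 1 /\
    f t = - (b * k)^-1 * g t + (b * k * (1 - k))^-1 * derive1 (conv E g) t +
      (1 - k)^-1 * E t * f 0).
Proof.
move=> cf; have cu := locally_AC_forced_part cf; split => [fg t t0|fg].
  have [dc c'E] := convolution_derive cu (op_ae fg) t0.
  split=> //; rewrite c'E {1}(opK cf (ltW t0)) (fg t t0).
  congr (_ + _); move: (conv r _ t) (g t) => x y.
  by field; rewrite k1 k_neq0 b_neq0.
have gu : {ae mu, forall t : R, 0 <= t -> g t = op (forced_part f) t}.
  apply: inv_ae => //.
  have fg' : {ae mu, forall t : R, 0 <= t -> f t = - (b * k)^-1 * g t +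
      (b * k * (1 - k))^-1 * derive1 (conv E g) t + (1 - k)^-1 * E t * f 0}.
    by apply: ae_gt0W; apply: aeW => t /fg[].
  apply: filterS2 fg' convolution_derive_ae => t ft c't t0.
  rewrite {1}(ft t0) (c't t0); congr (_ + _); move: (conv r g t) (g t) => x y.
  by field; rewrite k1 k_neq0 b_neq0.
move=> t t0; have [_] := fg t t0.
have [_ ->] := convolution_derive cu gu t0.
rewrite {1}(opK cf (ltW t0)) => /addIr.
move: (conv r _ t) (op _ t) (g t) => x y z.
have -> : (b * (1 - k))^-1 * y = - (b * k)^-1 * y + (b * k * (1 - k))^-1 * y.
  by field; rewrite k1 k_neq0 b_neq0.
rewrite (mulrDr _ y x) -!addrA => /addIr /mulfI; apply.
by rewrite oppr_eq0 invr_eq0 mulf_neq0.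
Qed.

Let derive1_shift (F : R -> R) x t :
  derive1 (fun s => F (s - x)) t = derive1 F (t - x).
Proof.
rewrite /derive1 (_ : (fun h => h^-1 *: (F (h + t - x) - F (t - x))) =
  (fun h => h^-1 *: (F (h + (t - x)) - F (t - x))))//.
by apply/funext => h; rewrite addrA.
Qed.

Let integrand t x := derive1 (fun s => E (s - x)) t * g x.

Let integrandE t x : x < t -> integrand t x = r (t - x) * g x.
Proof.
move=> xt; have tx0 : 0 < t - x by rewrite subr_gt0.
by have [_ <-] := dE tx0; rewrite /integrand derive1_shift.
Qed.

Let ae_interior t (Q : R -> Prop) : (forall x, 0 < x -> x < t -> Q x) ->
  {ae mu, forall x : R, (`[0, t]%classic : set R) x -> Q x}.
Proof.
move=> H.
apply: filterS2 (ae_neq 0) (ae_neq t) => x x0 xt.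
rewrite /= in_itv/= => /andP[xge0 xlet].
by apply: H; rewrite lt_neqAle ?xt// eq_sym x0.
Qed.

Let measurable_rg t : measurable_fun (`[0, t]%classic : set R)
  (fun x => (r (t - x) * g x)%:E).
Proof.
apply/measurable_EFinP; apply: measurable_funM.
  by apply/measurable_EFinP; exact: measurable_int (integrable_reflect t lr).
by have /loc_integrableP/(_ t)/measurable_int/measurable_EFinP := lg.
Qed.

Let integral_integrand t : \int[mu]_(x in `[0, t]) integrand t x = conv r g t.
Proof.
rewrite convE /Rintegral; congr fine.
apply: ae_eq_integral_left; [by []|exact: measurable_rg|].
apply: (@ae_interior t (fun x => (integrand t x)%:E = (r (t - x) * g x)%:E)).
by move=> x _ xt; rewrite integrandE.
Qed.

Let integrable_integrand u t : loc_bounded u ->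
  (forall t, 0 < t -> u t = g t) ->
  mu.-integrable `[0, t] (EFin \o integrand t).
Proof.
move=> bu ug.
have i1 : mu.-integrable `[0, t] (fun x => (r (t - x) * u x)%:E).
  exact: conv_integrable.
have [m1 fin1] := integrableP _ _ _ i1.
have io x : 0 < x -> x < t -> integrand t x = r (t - x) * u x.
  by move=> x0 xt; rewrite integrandE// ug.
apply/integrableP; split.
  have m2 : measurable_fun (`]0, t[%classic : set R) (fun x => r (t - x) * u x).
    apply/measurable_EFinP; apply: measurable_funS m1 => //.
    by move=> x /=; rewrite !in_itv/= => /andP[/ltW -> /ltW ->].
  apply/measurable_EFinP; apply: (@measurable_fun_itv_cc _ 0 t false true).
  apply: eq_measurable_fun m2 => x.
  by rewrite inE/= in_itv/= => /andP[x0 xt]; rewrite io.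
apply: le_lt_trans fin1; rewrite le_eqVlt; apply/orP; left; apply/eqP.
apply: ae_eq_integral_left; [by []|exact: measurableT_comp|].
apply: (@ae_interior t
  (fun x => `|(integrand t x)%:E|%E = `|(r (t - x) * u x)%:E|%E)).
by move=> x x0 xt; rewrite io.
Qed.

(** The same upgrade from almost everywhere to everywhere, by comparison with
[opK], the coefficient of g t being nonzero. *)
Lemma kernel_formula f : locally_AC f ->
  (forall t, 0 < t -> op (forced_part f) t = g t) <->
  (forall t, 0 < t ->
    mu.-integrable `[0, t]
      (EFin \o (fun x => derive1 (fun s => E (s - x)) t * g x)) /\
    f t = (b * (1 - k))^-1 * g t + (b * k * (1 - k))^-1 *
        \int[mu]_(x in `[0, t]) (derive1 (fun s => E (s - x)) t * g x) +
      (1 - k)^-1 * E t * f 0).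
Proof.
move=> cf; have cu := locally_AC_forced_part cf.
have cop : locally_AC (op (forced_part f)) by exact: locally_AC_volterra_op.
have bop := locally_AC_bounded cop; have lop := loc_integrable_bounded bop.
split => [fg t t0|fg].
  split; first exact: (integrable_integrand t bop fg).
  have := integral_integrand t; rewrite /integrand => ->.
  by rewrite {1}(opK cf (ltW t0)) -(conv_ae_eq lr lg lop (op_ae fg)) fg.
have fg' t : 0 < t -> f t = (b * (1 - k))^-1 * g t +
     (b * k * (1 - k))^-1 * conv r g t + (1 - k)^-1 * E t * f 0.
  by move=> /fg[_]; have := integral_integrand t; rewrite /integrand => ->.
have gu := inv_ae cf (ae_gt0W (aeW mu fg')).
move=> t t0; have := fg' t t0.
rewrite {1}(opK cf (ltW t0)) (conv_ae_eq lr lg lop gu) => /addIr/addIr/mulfI; apply.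
by rewrite invr_eq0 mulf_neq0.
Qed.

End relaxation_equation.

(** * Solution of the ABC equation *)

Theorem mainTheorem6 (R : realType) (B : R -> R)
    (B_gt0 : forall x : R, 0 <= x <= 1 -> 0 < B x)
    (B0 : B 0 = 1) (B1 : B 1 = 1)
    (alpha : R) (alpha01 : 0 < alpha < 1)
    (A : R) (A_neq0 : A != 0)
    (k : R) (kE : k = (1 - alpha) / B alpha * A) (k_neq1 : k != 1)
    (g : R -> R) (g_laplace : laplace_transformable g) :
  let mu := @lebesgue_measure R in
  let E (t : R) :=
    mittag_leffler alpha
      (k * alpha / ((1 - k) * (1 - alpha)) * t `^ alpha) in
  let formula1 (f : R -> R) := forall t : R, 0 < t ->
    let conv (s : R) := \int[mu]_(x in `[0, s]) (E (s - x) * g x) in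
    derivable conv t 1 /\
    f t = - A^-1 * g t + (A * (1 - k))^-1 * derive1 conv t
          + (1 - k)^-1 * E t * f 0 in
  let formula2 (f : R -> R) := forall t : R, 0 < t ->
    let integrand (x : R) := derive1 (fun s : R => E (s - x)) t * g x in
    mu.-integrable `[0, t] (EFin \o integrand) /\
    f t = k / (A * (1 - k)) * g t
          + (A * (1 - k))^-1 * \int[mu]_(x in `[0, t]) integrand x
          + (1 - k)^-1 * E t * f 0 in
  [/\ (forall f : R -> R, laplace_transformable f -> locally_AC f ->
         (ABC_solution B alpha A g f <-> formula1 f) /\
         (ABC_solution B alpha A g f <-> formula2 f)),
      (forall f1 f2 : R -> R,
         ABC_solution B alpha A g f1 -> ABC_solution B alpha A g f2 ->
         forall t : R, 0 <= t -> f1 t = f2 t) &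
      (locally_AC g -> exists f : R -> R, ABC_solution B alpha A g f)].
Proof.
move=> mu E formula1 formula2.
have [a0 a1] := andP alpha01.
have Ba : 0 < B alpha by apply: B_gt0; rewrite !ltW.
have a1' : 1 - alpha != 0 by rewrite subr_eq0 eq_sym lt_eqF.
have k1' : 1 - k != 0 by rewrite subr_eq0 eq_sym.
have Bn0 : B alpha != 0 by rewrite gt_eqF.
pose b := B alpha / (1 - alpha).
have b0 : b != 0 by rewrite mulf_neq0// invr_eq0.
have AE : A = b * k by rewrite kE /b; field; rewrite Bn0 a1'.
have k0 : k != 0.
  by apply: contraNneq A_neq0 => k0; rewrite AE k0 mulr0.
have lg := laplace_loc_integrable g_laplace.
pose m := k * alpha / ((1 - k) * (1 - alpha)).
pose n := - alpha / (1 - alpha).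
pose K (c : R) := ml_kernel alpha alpha c.
have lK c : loc_integrable (K c) by exact: loc_integrable_ml_kernel.
pose r := m *: K m; pose q := n *: K n.
have lr : loc_integrable r by exact: loc_integrableZ.
have lq : loc_integrable q by exact: loc_integrableZ.
have b1 : loc_bounded (cst 1 : R -> R) by exact: loc_bounded_cst.
have rq c : loc_bounded c ->
    conv r (conv q c) = (k - 1) *: conv r c + (- k) *: conv q c.
  move=> bc; have bKc i : loc_bounded (conv (K i) c) by exact: loc_bounded_conv.
  rewrite /r /q !convZl// ?convZr//; last exact: loc_boundedZ.
  have /(congr1 (@^~ _)) R1 := ml_kernel_resolvent a0 a1 m n bc.
  have kn : k * n = (k - 1) * m by rewrite /n /m; field; rewrite k1' a1'.
  have mn : m * n = (k - 1) * m * (m - n).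
    by rewrite /n /m; field; rewrite k1' a1'.
  apply/funext => t; have := R1 t.
  change ((m - n) * conv (K m) (conv (K n) c) t =
      conv (K m) c t - conv (K n) c t ->
    m * (n * conv (K m) (conv (K n) c) t) =
    (k - 1) * (m * conv (K m) c t) + (- k) * (n * conv (K n) c t)).
  move: (conv (K m) (conv (K n) c) t) (conv (K m) c t) (conv (K n) c t) => z x y zE.
  rewrite (mulrA m n z) mn -[LHS]mulrA zE mulNr (mulrA k n y) kn.
  by ring.
have EE t : 0 <= t -> E t = (cst 1 + conv r (cst 1)) t.
  by move=> t0; rewrite /E mittag_leffler_relaxation// /r convZl.
pose e (t : R) := mittag_leffler alpha (n * t `^ alpha).
have eE t : 0 <= t -> e t = (cst 1 + conv q (cst 1)) t.
  by move=> t0; rewrite /e mittag_leffler_relaxation// /q convZl.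
have dE t : 0 < t -> derivable E t 1 /\ derive1 E t = r t.
  by move=> t0; exact: mittag_leffler_derive.
pose op f := volterra_op q b k (forced_part r k f).
have solP f : locally_AC f -> forall t, 0 <= t ->
    ABC_derivative B alpha f t - A * f t = op f t.
  by move=> cf t t0; rewrite AE /op -(relaxation_operatorE b lr lq k1' rq eE cf t0).
have solE f : laplace_transformable f -> locally_AC f ->
    ABC_solution B alpha A g f <-> (forall t, 0 < t -> op f t = g t).
  move=> lf cf; split=> [[_ _ h] t t0|h].
    by rewrite -solP ?h// ltW.
  by split=> // t t0; rewrite solP ?h// ltW.
split.
- move=> f lf cf; split.
    apply: (iff_trans (solE f lf cf)); rewrite /formula1 AE.
    exact: (derivative_formula lr lq b0 k0 k1' rq EE lg cf).
  apply: (iff_trans (solE f lf cf)); rewrite /formula2 AE.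
  have -> : k / (b * k * (1 - k)) = (b * (1 - k))^-1.
    by field; rewrite k1' k0 b0.
  exact: (kernel_formula lr lq b0 k0 k1' rq EE lg dE cf).
- move=> f1 f2 s1 s2.
  have [lf1 cf1 _] := s1; have [lf2 cf2 _] := s2.
  have /(solE _ lf1 cf1) g1 := s1; have /(solE _ lf2 cf2) g2 := s2.
  have cu f : locally_AC f -> locally_AC (forced_part r k f).
    by move=> cf; exact: locally_AC_forced_part.
  have cop f : locally_AC f -> locally_AC (op f).
    by move=> cf; apply: locally_AC_volterra_op => //; exact: cu.
  have op12 t : 0 < t -> op f1 t = op f2 t by move=> t0; rewrite g1// g2.
  have op0 := locally_AC_eq0 (cop _ cf1) (cop _ cf2) op12.
  have op12' t : 0 <= t -> op f1 t = op f2 t.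
    by rewrite le_eqVlt => /predU1P[<-//|/op12].
  (* the ABC derivative vanishes at 0, so both sides are - A times f(0) *)
  have f0 : f1 0 = f2 0.
    apply: (mulfI A_neq0); apply: oppr_inj.
    have := op0; rewrite -!solP// /ABC_derivative set_itv1 !Rintegral_set1.
    by rewrite !mulr0 !sub0r.
  have inv f : locally_AC f -> volterra_inv r b k (op f) = forced_part r k f.
    move=> cf; apply: (volterra_opK lr lq b0 k0 k1' rq).
    exact: locally_AC_bounded (cu _ cf).
  move=> t t0; rewrite (forced_partE k EE f1 t0) (forced_partE k EE f2 t0) f0.
  congr (_ + _); rewrite -(inv _ cf1) -(inv _ cf2).
  change ((b * (1 - k))^-1 * op f1 t + (b * k * (1 - k))^-1 * conv r (op f1) t =
          (b * (1 - k))^-1 * op f2 t + (b * k * (1 - k))^-1 * conv r (op f2) t).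
  by rewrite (op12' _ t0) (conv_congr (fun x _ => erefl (r x)) op12').
- move=> cg.
  (* at t = 0 the equation reads - A f(0) = g(0) *)
  pose f0 := - A^-1 * g 0.
  pose h := volterra_inv r b k g.
  pose f := h + ((1 - k)^-1 * f0) *: (cst 1 + conv r (cst 1)).
  have lap_r : laplace_transformable r.
    by apply: laplace_transformableZ; exact: laplace_ml_kernel.
  have lf : laplace_transformable f.
    apply: laplace_transformableD.
      apply: laplace_transformableD; apply: laplace_transformableZ => //.
      exact: laplace_transformable_conv.
    apply: laplace_transformableZ; apply: laplace_transformableD.
      exact: laplace_transformable_cst.
    by apply: laplace_transformable_conv => //; exact: laplace_transformable_cst.
  have cf : locally_AC f.
    apply: locally_AC_D.
      by apply: locally_AC_D; apply: locally_AC_Z => //; exact: locally_AC_conv.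
    apply: locally_AC_Z; apply: locally_AC_D; first exact: locally_AC_cst.
    by apply: locally_AC_conv => //; exact: locally_AC_cst.
  have f00 : f 0 = f0.
    change ((b * (1 - k))^-1 * g 0 + (b * k * (1 - k))^-1 * conv r g 0 +
      (1 - k)^-1 * f0 * (1 + conv r (cst 1) 0) = f0).
    by rewrite !conv_at0 /f0 AE; field; rewrite k1' k0 b0.
  exists f; apply/(solE _ lf cf) => t _.
  have -> : op f = g; last by [].
  rewrite /op.
  have -> : forced_part r k f = h.
    rewrite /forced_part /homogeneous_part f00 /f; apply/funext => s.
    change (h s + (1 - k)^-1 * f0 * (cst 1 + conv r (cst 1)) s +
      (-1) * ((1 - k)^-1 * f0 * (cst 1 + conv r (cst 1)) s) = h s).
    by ring.
  exact: (volterra_invK lr lq b0 k0 k1' rq (locally_AC_bounded cg)).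
Qed.
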